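(* Let $\mathcal{C}$ be a root class of groups consisting only of periodic groups, and let $$\mathcal{G}(\Gamma) = \big(\Gamma,\ G_{v}\ (v \in \mathcal{V}),\ H_{e}\ (e \in \mathcal{E}),\ \varphi_{\varepsilon e}\ (e \in \mathcal{E},\ \varepsilon = \pm 1)\big)$$ be a graph of groups over a graph $\Gamma$ with vertex set $\mathcal{V}$ and edge set $\mathcal{E}$. Suppose that $\Gamma$ is a finite tree and $H_{e}\varphi_{\varepsilon e}$ is a proper central subgroup of $G_{e(\varepsilon)}$ for all $e \in \mathcal{E}$, $\varepsilon = \pm 1$. Suppose also that, for each $v \in \mathcal{V}$, $G_{v}$ is residually a $\mathcal{C}\mbox{-}\mathcal{BN}_{\mathfrak{P}(\mathcal{C})}$-group and has a homomorphism onto a $\mathcal{C}\mbox{-}\mathcal{BN}_{\mathfrak{P}(\mathcal{C})}$-group that acts injectively on all the subgroups $H_{e}\varphi_{\varepsilon e}$ ($e \in \mathcal{E}$, $\varepsilon = \pm 1$, $v = e(\varepsilon)$). Then $\pi_{1}(\mathcal{G}(\Gamma))$ is residually a $\mathcal{C}$-group if and only if, for any $e \in \mathcal{E}$, $\varepsilon = \pm 1$, $H_{e}\varphi_{\varepsilon e}$ is $\mathfrak{P}(\mathcal{C})'$-isolated in $G_{e(\varepsilon)}$.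
   Context: As usual, classes of groups are closed under isomorphism. A class of groups $\mathcal{C}$ is called a root class if it contains at least one non-trivial group and is closed under taking subgroups, extensions, and Cartesian (i.e. unrestricted direct) products of the form $\prod_{y \in Y} X_{y}$, where $X, Y \in \mathcal{C}$ and $X_{y}$ is an isomorphic copy of $X$ for each $y \in Y$. For any class of groups $\mathcal{D}$, a group $X$ is residually a $\mathcal{D}$-group if for any $x \in X \setminus \{1\}$ there exists a homomorphism $\sigma$ of $X$ onto a group from $\mathcal{D}$ such that $x\sigma \ne 1$. For a class of periodic groups $\mathcal{C}$, $\mathfrak{P}(\mathcal{C})$ denotes the set of all primes each of which divides the order of an element of some $\mathcal{C}$-group, and $\mathfrak{P}(\mathcal{C})'$ is the set of all primes not in $\mathfrak{P}(\mathcal{C})$. A subgroup $Y$ of a group $X$ is $\mathfrak{P}(\mathcal{C})'$-isolated in $X$ if, for any $x \in X$ and $q \in \mathfrak{P}(\mathcal{C})'$, $x^{q} \in Y$ implies $x \in Y$. A group is $\mathfrak{P}(\mathcal{C})'$-torsion-free if its trivial subgroup is $\mathfrak{P}(\mathcal{C})'$-isolated. For an abelian group $A$ and $p \in \mathfrak{P}(\mathcal{C})$, the subgroup of all elements of $p$-power order of $A$ is called a primary $\mathfrak{P}(\mathcal{C})$-component of $A$. An abelian group $A$ is $\mathcal{C}$-bounded if, for any quotient group $B$ of $A$, each primary $\mathfrak{P}(\mathcal{C})$-component of $B$ has a finite exponent and a cardinality not exceeding the cardinality of some $\mathcal{C}$-group. A nilpotent group is $\mathcal{C}$-bounded if it has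 at least one finite central series with $\mathcal{C}$-bounded abelian factors. $\mathcal{C}\mbox{-}\mathcal{BN}_{\mathfrak{P}(\mathcal{C})}$ denotes the class of all $\mathfrak{P}(\mathcal{C})'$-torsion-free $\mathcal{C}$-bounded nilpotent groups. A homomorphism acts injectively on a subgroup if its restriction to that subgroup is injective. Graph of groups: $\Gamma$ is a non-empty undirected connected graph with vertex set $\mathcal{V}$ and edge set $\mathcal{E}$. Directions of all edges are chosen arbitrarily, and the ends of $e \in \mathcal{E}$ are denoted $e(1)$ and $e(-1)$. To each vertex $v$ is assigned a group $G_{v}$, and to each edge $e$ a group $H_{e}$ and injective homomorphisms $\varphi_{+e}\colon H_{e} \to G_{e(1)}$, $\varphi_{-e}\colon H_{e} \to G_{e(-1)}$ (written on the right). $\pi_{1}(\mathcal{G}(\Gamma))$ is the fundamental group of the graph of groups in the usual (Bass–Serre) sense; when $\Gamma$ is a tree it is the tree product of the groups $G_v$, i.e. the quotient of the free product of the groups $G_{v}$ ($v \in \mathcal{V}$) by the relations $h\varphi_{+e} = h\varphi_{-e}$ ($e \in \mathcal{E}$, $h \in H_{e}$). *)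

(* Defs.v *)
From HB Require Import structures.
From mathcomp Require Import all_boot.
From mathcomp Require Import boolp classical_sets functions cardinality.

Set Implicit Arguments.
Unset Strict Implicit.
Unset Printing Implicit Defensive.

Import Algebra.

Local Open Scope quotient_scope.
Local Open Scope classical_set_scope.
Local Open Scope card_scope.
Local Open Scope group_scope.

Notation hom := UMagmaMorphism.type.

Record subgroup (X : groupType) := Subgroup {
  carrier :> set X;
  subgroup1 : carrier 1;
  subgroupM : forall x y, carrier x -> carrier y -> carrier (x * y);
  subgroupV : forall x, carrier x -> carrier x^-1
}.

Section SubgroupGroup.
Variables (X : groupType) (S : subgroup X).

Definition subgroup_pred : pred X := fun x => x \in (S : set X).
Definition subgroup_sort : Type := {x : X | subgroup_pred x}.

Lemma subgroup_pred_closed : group_closed subgroup_pred.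
Proof.
split; first exact/mem_set/subgroup1.
move=> x y /set_mem Sx /set_mem Sy; apply/mem_set.
by apply: subgroupM => //; apply: subgroupV.
Qed.

HB.instance Definition _ := SubChoice.on subgroup_sort.
HB.instance Definition _ :=
  SubChoice_isSubGroup.Build X subgroup_pred subgroup_sort subgroup_pred_closed.

Definition subgroup_group : groupType := subgroup_sort.
End SubgroupGroup.

Record normal_subgroup (X : groupType) := NormalSubgroup {
  nsubgroup :> subgroup X;
  nsubgroupJ : forall x y, carrier nsubgroup x -> carrier nsubgroup (x ^ y)
}.

Section Quotient.
Variables (X : groupType) (N : normal_subgroup X).

Definition coset_rel : rel X := fun x y => `[< carrier N (x^-1 * y) >].

Lemma coset_rel_refl : reflexive coset_rel.
Proof. by move=> x; apply/asboolP; rewrite mulVg; apply: subgroup1. Qed.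

Lemma coset_rel_sym : symmetric coset_rel.
Proof.
have sub x y : coset_rel x y -> coset_rel y x.
  move=> /asboolP /subgroupV Nxy; apply/asboolP.
  by rewrite -[y^-1 * x]invgK invgM invgK.
by move=> x y; apply/idP/idP; apply: sub.
Qed.

Lemma coset_rel_trans : transitive coset_rel.
Proof.
move=> y x z /asboolP Nxy /asboolP Nyz; apply/asboolP.
by have := subgroupM Nxy Nyz; rewrite -mulgA mulVKg.
Qed.

Definition coset_equiv :=
  EquivRel coset_rel coset_rel_refl coset_rel_sym coset_rel_trans.

Definition coset : Type := {eq_quot coset_equiv}.
HB.instance Definition _ := Choice.on coset.
HB.instance Definition _ := EqQuotient.on coset.

Definition coset_mul (a b : coset) : coset := \pi_coset (repr a * repr b).
Definition coset_one : coset := \pi_coset 1.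
Definition coset_inv (a : coset) : coset := \pi_coset (repr a)^-1.

Lemma coset_eq (x y : X) : carrier N (x^-1 * y) -> \pi_coset x = \pi_coset y.
Proof. by move=> Nxy; apply/eqmodP/asboolP. Qed.

Lemma coset_reprE (x : X) : carrier N (x^-1 * repr (\pi_coset x)).
Proof.
apply/asboolP; have : \pi_coset x = \pi_coset (repr (\pi_coset x)).
  by rewrite reprK.
by move/eqmodP.
Qed.

Lemma coset_mulE (x y : X) :
  coset_mul (\pi_coset x) (\pi_coset y) = \pi_coset (x * y).
Proof.
apply/esym/coset_eq; rewrite invgM.
have Nx := coset_reprE x; have Ny := coset_reprE y.
move: (repr _) (repr _) Nx Ny => x' y' Nx Ny.
have := subgroupM (nsubgroupJ y Nx) Ny.
by rewrite conjgE !mulgA mulgK.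
Qed.

Lemma coset_invE (x : X) : coset_inv (\pi_coset x) = \pi_coset x^-1.
Proof.
apply/esym/coset_eq; rewrite invgK.
have := nsubgroupJ x^-1 (subgroupV (coset_reprE x)).
by rewrite conjgE !invgM !invgK !mulgA mulgK.
Qed.

Lemma coset_mulA : associative coset_mul.
Proof.
elim/quotW=> x; elim/quotW=> y; elim/quotW=> z.
by rewrite [coset_mul (\pi y) _]coset_mulE [coset_mul (\pi x) (\pi y)]coset_mulE !coset_mulE mulgA.
Qed.

Lemma coset_mul1 : left_id coset_one coset_mul.
Proof. by elim/quotW=> x; rewrite /coset_one coset_mulE mul1g. Qed.

Lemma coset_mulg1 : right_id coset_one coset_mul.
Proof. by elim/quotW=> x; rewrite /coset_one coset_mulE mulg1. Qed.

Lemma coset_mulV : left_inverse coset_one coset_inv coset_mul.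
Proof. by elim/quotW=> x; rewrite coset_invE coset_mulE mulVg. Qed.

Lemma coset_mulgV : right_inverse coset_one coset_inv coset_mul.
Proof. by elim/quotW=> x; rewrite coset_invE coset_mulE mulgV. Qed.

HB.instance Definition _ := isGroup.Build coset
  coset_mulA coset_mul1 coset_mulg1 coset_mulV coset_mulgV.

Definition quotient_group : groupType := coset.

Definition quotient_map (x : X) : quotient_group := \pi_coset x.

Lemma quotient_mapF : {morph quotient_map : x y / x / y}.
Proof.
by move=> x y; rewrite /quotient_map -coset_mulE -coset_invE.
Qed.

HB.instance Definition _ :=
  isGroupMorphism.Build X quotient_group quotient_map quotient_mapF.
End Quotient.

Section ImageSubgroup.
Variables (X Y : groupType) (f : hom X Y) (S : subgroup X).

Lemma image_subgroup1 : (f @` S) 1.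
Proof. by exists 1; [apply: subgroup1 | apply: gmulf1]. Qed.

Lemma image_subgroupM x y : (f @` S) x -> (f @` S) y -> (f @` S) (x * y).
Proof.
move=> [a Sa <-] [b Sb <-]; exists (a * b); last exact: gmulfM.
exact: subgroupM.
Qed.

Lemma image_subgroupV x : (f @` S) x -> (f @` S) x^-1.
Proof.
move=> [a Sa <-]; exists a^-1; first exact: subgroupV.
exact: gmulfV.
Qed.

Definition image_subgroup : subgroup Y :=
  Subgroup image_subgroup1 image_subgroupM image_subgroupV.
End ImageSubgroup.

Section CartesianProduct.
Variables (I : Type) (X : I -> groupType).

Definition cartesian_sort : Type := forall i, X i.

HB.instance Definition _ := gen_eqMixin cartesian_sort.
HB.instance Definition _ := gen_choiceMixin cartesian_sort.

Definition cartesian_mul (a b : cartesian_sort) : cartesian_sort :=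
  fun i => a i * b i.
Definition cartesian_one : cartesian_sort := fun=> 1.
Definition cartesian_inv (a : cartesian_sort) : cartesian_sort :=
  fun i => (a i)^-1.

Lemma cartesian_mulA : associative cartesian_mul.
Proof. by move=> a b c; apply: functional_extensionality_dep => i; apply: mulgA. Qed.
Lemma cartesian_mul1 : left_id cartesian_one cartesian_mul.
Proof. by move=> a; apply: functional_extensionality_dep => i; apply: mul1g. Qed.
Lemma cartesian_mulg1 : right_id cartesian_one cartesian_mul.
Proof. by move=> a; apply: functional_extensionality_dep => i; apply: mulg1. Qed.
Lemma cartesian_mulV : left_inverse cartesian_one cartesian_inv cartesian_mul.
Proof. by move=> a; apply: functional_extensionality_dep => i; apply: mulVg. Qed.
Lemma cartesian_mulgV : right_inverse cartesian_one cartesian_inv cartesian_mul.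
Proof. by move=> a; apply: functional_extensionality_dep => i; apply: mulgV. Qed.

HB.instance Definition _ := isGroup.Build cartesian_sort
  cartesian_mulA cartesian_mul1 cartesian_mulg1 cartesian_mulV cartesian_mulgV.

Definition cartesian_product : groupType := cartesian_sort.
End CartesianProduct.

Definition isomorphic (X Y : groupType) : Prop :=
  exists f : hom X Y, bijective f.

Definition center (X : groupType) : set X := [set x | forall y, commute x y].
Arguments center : clear implicits.

Definition abelian (X : groupType) : Prop := forall x y : X, commute x y.

Definition periodic (X : groupType) : Prop :=
  forall x : X, exists2 n, (0 < n)%N & x ^+ n = 1.

Definition has_order (X : groupType) (x : X) (n : nat) : Prop :=
  [/\ (0 < n)%N, x ^+ n = 1 &
      forall m, (0 < m)%N -> x ^+ m = 1 -> (n <= m)%N].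

Definition group_class := groupType -> Prop.

Record root_class (C : group_class) : Prop := RootClass {
  root_isomorphic : forall X Y, isomorphic X Y -> C X -> C Y;
  root_nontrivial : exists2 X : groupType, C X & exists x : X, x <> 1;
  root_subgroup : forall (X : groupType) (S : subgroup X),
    C X -> C (subgroup_group S);
  root_extension : forall (X : groupType) (N : normal_subgroup X),
    C (subgroup_group N) -> C (quotient_group N) -> C X;
  root_cartesian : forall (X Y : groupType) (XX : Y -> groupType),
    C X -> C Y -> (forall y, isomorphic X (XX y)) -> C (cartesian_product XX)
}.

Definition residually (D : group_class) (X : groupType) : Prop :=
  forall x : X, x <> 1 ->
    exists2 Y : groupType, D Y &
      exists sigma : hom X Y,
        range sigma = [set: Y] /\ sigma x <> 1.

Definition primes_of (C : group_class) : set nat :=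
  [set p | prime p /\ exists2 X : groupType, C X &
             exists (x : X) (n : nat), has_order x n /\ (p %| n)%N].

Definition primes_of' (C : group_class) : set nat :=
  [set q | prime q /\ ~ primes_of C q].

Definition isolated (Q : set nat) (X : groupType) (Y : set X) : Prop :=
  forall (x : X) (q : nat), Q q -> Y (x ^+ q) -> Y x.

Definition torsion_free (Q : set nat) (X : groupType) : Prop :=
  isolated Q [set 1 : X].

Definition primary_component (A : groupType) (p : nat) : set A :=
  [set x | exists k, x ^+ (p ^ k)%N = 1].

Definition bounded_abelian (C : group_class) (A : groupType) : Prop :=
  abelian A /\
  forall (N : normal_subgroup A) (p : nat), primes_of C p ->
    let P := primary_component (A := quotient_group N) p in
    (exists2 n, (0 < n)%N & forall x, P x -> x ^+ n = 1) /\
    (exists2 X : groupType, C X & P #<= [set: X]).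

(* The factor Z i.+1 / Z i is realised inside X / Z i, as the image of Z i.+1
   under the natural map. *)
Definition series_factor (X : groupType) (Z : nat -> normal_subgroup X)
    (i : nat) : subgroup (quotient_group (Z i)) :=
  image_subgroup (@quotient_map X (Z i)) (Z i.+1).

Definition central_series (X : groupType) (n : nat)
    (Z : nat -> normal_subgroup X) : Prop :=
  [/\ (Z 0 : set X) = [set 1], (Z n : set X) = [set: X] &
      forall i, (i < n)%N ->
        (Z i : set X) `<=` Z i.+1 /\
        (series_factor Z i : set _) `<=` center (quotient_group (Z i))].

Definition bounded_nilpotent (C : group_class) (X : groupType) : Prop :=
  exists n (Z : nat -> normal_subgroup X), central_series n Z /\
    forall i, (i < n)%N ->
      bounded_abelian C (subgroup_group (series_factor Z i)).

(* The class C-BN_{P(C)}, where P(C) is [primes_of C]. *)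
Definition BN (C : group_class) : group_class :=
  fun X => torsion_free (primes_of' C) X /\ bounded_nilpotent C X.

(* [ends e true] is e(1) and [ends e false] is e(-1); loops and multiple edges
   are allowed. *)
Record finite_graph := FiniteGraph {
  vertex : finType;
  edge : finType;
  ends : edge -> bool -> vertex
}.

Section Trees.
Variable Gamma : finite_graph.

Definition adjacent : rel (vertex Gamma) :=
  fun u v => [exists e : edge Gamma, exists eps : bool,
                (ends e eps == u) && (ends e (~~ eps) == v)].

Definition connected : Prop :=
  (0 < #|vertex Gamma|)%N /\ forall u v, connect adjacent u v.

(* The pair (e, eps) is the edge e traversed from e(eps) to e(-eps). *)
Definition origin (o : edge Gamma * bool) : vertex Gamma := ends o.1 o.2.
Definition terminus (o : edge Gamma * bool) : vertex Gamma := ends o.1 (~~ o.2).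

Definition circuit (p : seq (edge Gamma * bool)) : bool :=
  [&& p != [::], cycle (fun o o' => terminus o == origin o') p,
      uniq (map origin p) & uniq (map fst p)].

Definition is_tree : Prop := connected /\ forall p, ~~ circuit p.
End Trees.

Record graph_of_groups (Gamma : finite_graph) := GraphOfGroups {
  vgroup : vertex Gamma -> groupType;
  egroup : edge Gamma -> groupType;
  emap : forall e eps, hom (egroup e) (vgroup (ends e eps));
  emap_inj : forall e eps, injective (emap e eps)
}.

Section TreeProduct.
Variables (Gamma : finite_graph) (GG : graph_of_groups Gamma).

Definition edge_subgroup e eps : set (vgroup GG (ends e eps)) :=
  range (emap GG e eps).
Arguments edge_subgroup : clear implicits.

Definition edge_subgroup_at v e eps (ev : ends e eps = v) :
    set (vgroup GG v) :=
  eq_rect (ends e eps) (fun w => set (vgroup GG w)) (edge_subgroup e eps) v ev.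

Definition word : Type := seq {v : vertex Gamma & vgroup GG v}.

Definition letter v (x : vgroup GG v) : word := [:: Tagged (vgroup GG) x].

(* The constructors [word_cong_one] and [word_cong_mul] generate the free
   product of the vertex groups, [word_cong_edge] amalgamates. *)
Inductive word_cong : word -> word -> Prop :=
| word_cong_refl w : word_cong w w
| word_cong_sym w w' : word_cong w w' -> word_cong w' w
| word_cong_trans w w' w'' :
    word_cong w w' -> word_cong w' w'' -> word_cong w w''
| word_cong_cat u u' w w' :
    word_cong u u' -> word_cong w w' -> word_cong (u ++ w) (u' ++ w')
| word_cong_one v : word_cong (letter (1 : vgroup GG v)) [::]
| word_cong_mul v (x y : vgroup GG v) :
    word_cong (letter x ++ letter y) (letter (x * y))
| word_cong_edge e (h : egroup GG e) :
    word_cong (letter (emap GG e true h)) (letter (emap GG e false h)).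

Definition word_rel : rel word := fun w w' => `[< word_cong w w' >].

Lemma word_rel_refl : reflexive word_rel.
Proof. by move=> w; apply/asboolP; apply: word_cong_refl. Qed.

Lemma word_rel_sym : symmetric word_rel.
Proof.
by move=> w w'; apply/asboolP/asboolP; apply: word_cong_sym.
Qed.

Lemma word_rel_trans : transitive word_rel.
Proof.
move=> w' w w'' /asboolP ww' /asboolP w'w''; apply/asboolP.
exact: word_cong_trans ww' w'w''.
Qed.

Definition word_equiv :=
  EquivRel word_rel word_rel_refl word_rel_sym word_rel_trans.

Definition word_class : Type := {eq_quot word_equiv}.
HB.instance Definition _ := Choice.on word_class.
HB.instance Definition _ := EqQuotient.on word_class.

Definition word_inv (w : word) : word :=
  rev [seq (let: existT v x := l in Tagged (vgroup GG) x^-1) | l <- w].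

Definition word_class_mul (a b : word_class) : word_class :=
  \pi_word_class (repr a ++ repr b).
Definition word_class_one : word_class := \pi_word_class [::].
Definition word_class_inv (a : word_class) : word_class :=
  \pi_word_class (word_inv (repr a)).

Lemma word_class_eq (w w' : word) :
  word_cong w w' -> \pi_word_class w = \pi_word_class w'.
Proof. by move=> ww'; apply/eqmodP/asboolP. Qed.

Lemma word_class_reprE (w : word) : word_cong (repr (\pi_word_class w)) w.
Proof.
apply/asboolP; have : \pi_word_class (repr (\pi_word_class w)) = \pi_word_class w.
  by rewrite reprK.
by move/eqmodP.
Qed.

Lemma word_class_mulE (w w' : word) :
  word_class_mul (\pi_word_class w) (\pi_word_class w') =
  \pi_word_class (w ++ w').
Proof. by apply/word_class_eq/word_cong_cat; apply: word_class_reprE. Qed.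

Lemma word_invK : involutive word_inv.
Proof.
move=> w; rewrite /word_inv map_rev revK -map_comp -[RHS]map_id.
by apply: eq_map => -[v x] /=; rewrite invgK.
Qed.

Lemma word_cong_mulV (w : word) : word_cong (w ++ word_inv w) [::].
Proof.
elim: w => [|[v x] w IHw]; first exact: word_cong_refl.
rewrite /word_inv /= rev_cons -cats1 -/(word_inv w) -cat_rcons catA.
rewrite -cats1 -!catA.
apply: (@word_cong_trans _ (letter x ++ letter x^-1)); last first.
  apply: word_cong_trans (word_cong_mul _ _) _.
  by rewrite mulgV; apply: word_cong_one.
apply: (@word_cong_cat (letter x) (letter x)); first exact: word_cong_refl.
rewrite catA; apply: (@word_cong_cat _ [::]) => //.
exact: word_cong_refl.
Qed.

Lemma word_cong_inv (w w' : word) :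
  word_cong w w' -> word_cong (word_inv w) (word_inv w').
Proof.
move=> ww'; apply: (@word_cong_trans _ (word_inv w ++ (w' ++ word_inv w'))).
  rewrite -{1}[word_inv w]cats0; apply: word_cong_cat (word_cong_refl _) _.
  exact/word_cong_sym/word_cong_mulV.
rewrite catA -[X in word_cong _ X]cat0s.
apply: word_cong_cat (word_cong_refl _).
apply: word_cong_trans (word_cong_cat (word_cong_refl _) (word_cong_sym ww')) _.
by rewrite -{2}[w]word_invK; apply: word_cong_mulV.
Qed.

Lemma word_class_invE (w : word) :
  word_class_inv (\pi_word_class w) = \pi_word_class (word_inv w).
Proof. by apply/word_class_eq/word_cong_inv; apply: word_class_reprE. Qed.

Lemma word_class_mulA : associative word_class_mul.
Proof.
elim/quotW=> x; elim/quotW=> y; elim/quotW=> z.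
by rewrite [word_class_mul (\pi y) _]word_class_mulE [word_class_mul (\pi x) (\pi y)]word_class_mulE !word_class_mulE catA.
Qed.

Lemma word_class_mul1 : left_id word_class_one word_class_mul.
Proof. by elim/quotW=> x; rewrite word_class_mulE. Qed.

Lemma word_class_mulg1 : right_id word_class_one word_class_mul.
Proof. by elim/quotW=> x; rewrite word_class_mulE cats0. Qed.

Lemma word_class_mulgV :
  right_inverse word_class_one word_class_inv word_class_mul.
Proof.
elim/quotW=> w; rewrite word_class_invE word_class_mulE.
exact/word_class_eq/word_cong_mulV.
Qed.

Lemma word_class_mulV :
  left_inverse word_class_one word_class_inv word_class_mul.
Proof.
elim/quotW=> w; rewrite word_class_invE word_class_mulE.
rewrite -{2}[w]word_invK.
exact/word_class_eq/word_cong_mulV.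
Qed.

HB.instance Definition _ := isGroup.Build word_class
  word_class_mulA word_class_mul1 word_class_mulg1
  word_class_mulV word_class_mulgV.

(* When Gamma is a tree, it is its own maximal subtree, so the fundamental group
   of GG has no stable letters and is this group. *)
Definition tree_product : groupType := word_class.
End TreeProduct.
Arguments edge_subgroup {Gamma} GG e eps.
Arguments edge_subgroup_at {Gamma} GG {v e eps} ev.

(* Main.v *)
Require Import Defs.
From HB Require Import structures.
From mathcomp Require Import all_boot.
From mathcomp Require Import boolp classical_sets functions cardinality.

Set Implicit Arguments.
Unset Strict Implicit.
Unset Printing Implicit Defensive.

Import Algebra.

Local Open Scope classical_set_scope.
Local Open Scope group_scope.
(** Write P for the tree product, pi for the set of primes of C, and H_e for the
    common image of the two copies of an edge group in P.

    Necessity. Let x lie in G_{e(1)} with x^q in the edge subgroup, q a prime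
    outside pi, and let y lie in G_{e(-1)} outside the edge subgroup. As x^q is
    central on both sides of e, it commutes with y. In a C-quotient the order of
    the image of x is prime to q, so this image is a power of the image of x^q
    and commutes with the image of y as well. Residual C-ness then gives
    [x, y] = 1 in P, whereas x y x^-1 y^-1 is an alternating word with letters
    outside the amalgamated subgroup as soon as x is outside it
    ([edge_amalgam_noncommuting]).

    Sufficiency splits into a statement on amalgams and one on nilpotent groups.

    - [tree_product_separated]: if every element of a vertex group outside an
      edge subgroup (or the trivial subgroup) L can be kept outside L by a
      homomorphism from P to a C-group, then the same holds for every element of
      P, so that P is residually C. The tree is grown edge by edge; each step is
      an amalgam of two groups A and B over H, and its elements are alternating
      words. The basic construction replaces a homomorphism s to a C-group Q by
      one to the wreath product of Q with some C-group: it equals s on A and the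
      conjugate of s by the indicator function d of s(H) on B, which is
      consistent because d commutes with s(H). The base component of the image
      of a word records how often the corresponding path in the coset graph of Q
      crosses each coset of s(H). If the word does not return to a coset within
      k letters, then this record shows, after the twist, that it does not
      return within k + 1 letters ([spread_step]). Iterating, every alternating
      word survives in a C-group ([alternating_separated]).

    - [tame_nilpotent_separates]: in a C-bounded nilpotent group an element, no
      pi'-power of which is trivial, survives in some C-quotient. In a
      suitable quotient the element has order p in pi; modulo a
      maximal normal subgroup avoiding it the group has a centre of bounded
      p-power exponent, hence is itself of bounded p-power exponent, and is
      assembled from boundedly many abelian p-groups of C-bounded cardinality,
      which lie in C.

    The two are linked by central products. Edge subgroups being central, the
    vertex groups embed in an iterated central product over the tree
    ([tree_central_product]), and after first mapping the vertex groups to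
    bounded nilpotent groups, injectively on edge subgroups, this central product
    is C-bounded nilpotent. The isolation hypothesis is used to choose these maps
    so that a given element of a vertex group stays outside the pi'-isolator of a
    given edge subgroup ([avoid_isolator]); dividing the central product by this
    edge subgroup leaves an element to which [tame_nilpotent_separates]
    applies. *)

(** * Homomorphisms, subgroups, quotients and powers *)

Section HomOf.
Variables (X Y : groupType) (f : X -> Y) (fM : {morph f : x y / x * y}).

Lemma morphM_divg : {morph f : x y / x / y}.
Proof.
have f1 : f 1 = 1 by apply: (mulgI (f 1)); rewrite -fM !mulg1.
move=> x y; rewrite fM; congr (_ * _).
by apply/esym/mulg1_eq; rewrite -fM mulgV.
Qed.

Definition hom_of : hom X Y :=
  HB.pack_for (hom X Y) f (isGroupMorphism.Build X Y f morphM_divg).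

Lemma hom_ofE x : hom_of x = f x.
Proof. by []. Qed.
End HomOf.

Definition hom_id (X : groupType) : hom X X := idfun.
Definition hom_comp (X Y Z : groupType) (g : hom Y Z) (f : hom X Y) : hom X Z :=
  g \o f.

Lemma hom_compE (X Y Z : groupType) (g : hom Y Z) (f : hom X Y) x :
  hom_comp g f x = g (f x).
Proof. by []. Qed.

Definition onto (X Y : Type) (f : X -> Y) : Prop := forall y, exists x, f x = y.

Section Basics.
Implicit Types X Y Z : groupType.

Lemma hom_inj X Y (f : hom X Y) : (forall x, f x = 1 -> x = 1) -> injective f.
Proof. exact: gmulf_inj. Qed.

Lemma hom1 X Y (f : hom X Y) : f 1 = 1. Proof. exact: gmulf1. Qed.
Lemma homM X Y (f : hom X Y) x y : f (x * y) = f x * f y.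
Proof. exact: gmulfM. Qed.
Lemma homV X Y (f : hom X Y) x : f x^-1 = (f x)^-1.
Proof. exact: gmulfV. Qed.
Lemma homX X Y (f : hom X Y) x n : f (x ^+ n) = f x ^+ n.
Proof. exact: gmulfXn. Qed.

Definition hom_one X Y : hom X Y := hom_of (fun x y : X => esym (mulg1 (1 : Y))).

Definition hom_pair X Y Z (f : hom X Y) (g : hom X Z) : hom X (Y * Z)%type.
Proof.
apply: (@hom_of X (Y * Z)%type (fun x => (f x, g x))) => x y.
by rewrite !homM.
Defined.

Definition hom_inl X Y : hom X (X * Y)%type := hom_pair (hom_id X) (hom_one X Y).
Definition hom_inr X Y : hom Y (X * Y)%type := hom_pair (hom_one Y X) (hom_id Y).
Definition hom_snd X Y : hom (X * Y)%type Y.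
Proof. by apply: (@hom_of (X * Y)%type Y (fun u => u.2)) => x y. Defined.

End Basics.

Section SubgroupOf.
Variables (X : groupType) (S : set X).

Definition is_subgroup : Prop :=
  [/\ S 1, forall x y, S x -> S y -> S (x * y) & forall x, S x -> S x^-1].

Definition is_normal : Prop :=
  is_subgroup /\ forall x y, S x -> S (x ^ y).

Definition subgroup_of (h : is_subgroup) : subgroup X :=
  @Subgroup X S (let: And3 h1 _ _ := h in h1)
    (let: And3 _ hM _ := h in hM) (let: And3 _ _ hV := h in hV).

Definition normal_of (h : is_normal) : normal_subgroup X :=
  @NormalSubgroup X (subgroup_of h.1) h.2.
End SubgroupOf.

Section Subgroups.
Variables (X : groupType).

Definition subgroup_val (S : subgroup X) : hom (subgroup_group S) X := val.

Lemma subgroup_val_inj (S : subgroup X) : injective (subgroup_val S).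
Proof. exact: val_inj. Qed.

Lemma subgroup_valP (S : subgroup X) (x : subgroup_group S) :
  carrier S (subgroup_val S x).
Proof. exact: set_mem (valP x). Qed.

Lemma subgroupX (S : subgroup X) x n : carrier S x -> carrier S (x ^+ n).
Proof.
move=> Sx; elim: n => [|n IHn]; first exact: subgroup1.
by rewrite expgS; apply: subgroupM.
Qed.

Definition subgroup_mk (S : subgroup X) (x : X) (Sx : carrier S x) :
  subgroup_group S := Sub x (mem_set Sx).

Lemma subgroup_mkK (S : subgroup X) (x : X) (Sx : carrier S x) :
  subgroup_val S (subgroup_mk Sx) = x.
Proof. exact: SubK. Qed.

Lemma corestrict_morph (Y : groupType) (f : hom Y X) (S : subgroup X)
  (Sf : forall y, carrier S (f y)) :
  {morph (fun y => subgroup_mk (Sf y)) : x y / x * y}.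
Proof.
move=> x y; apply: subgroup_val_inj; rewrite [RHS]homM !subgroup_mkK.
exact: homM.
Qed.

Definition corestrict (Y : groupType) (f : hom Y X) (S : subgroup X)
  (Sf : forall y, carrier S (f y)) : hom Y (subgroup_group S) :=
  hom_of (corestrict_morph Sf).

Lemma corestrictE (Y : groupType) (f : hom Y X) (S : subgroup X)
  (Sf : forall y, carrier S (f y)) y :
  subgroup_val S (corestrict Sf y) = f y.
Proof. exact: subgroup_mkK. Qed.

Definition range_subgroup (Y : groupType) (f : hom Y X) : subgroup X :=
  image_subgroup f (Subgroup (carrier := [set: Y]) I
    (fun _ _ _ _ => I) (fun _ _ => I)).

Lemma range_subgroupP (Y : groupType) (f : hom Y X) x :
  carrier (range_subgroup f) x <-> exists y, f y = x.
Proof. by split=> [[y _ <-]|[y <-]]; exists y. Qed.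

End Subgroups.

Lemma kernel_is_normal (X Y : groupType) (f : hom X Y) :
  is_normal [set x | f x = 1].
Proof.
split=> [|x y /=]; last by rewrite gmulfJ => ->; apply: conj1g.
split=> [|x y|x] /=; first exact: hom1.
- by rewrite homM => -> ->; rewrite mulg1.
- by rewrite homV => ->; rewrite invg1.
Qed.

Definition kernel (X Y : groupType) (f : hom X Y) : normal_subgroup X :=
  normal_of (kernel_is_normal f).

Lemma preim_is_normal (X Y : groupType) (f : hom X Y) (N : normal_subgroup Y) :
  is_normal [set x | carrier N (f x)].
Proof.
split=> [|x y /=]; last by rewrite gmulfJ; apply: nsubgroupJ.
split=> [|x y|x] /=; first by rewrite hom1; apply: subgroup1.
- by rewrite homM; apply: subgroupM.
- by rewrite homV; apply: subgroupV.
Qed.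

Definition preim_normal (X Y : groupType) (f : hom X Y) (N : normal_subgroup Y) :
  normal_subgroup X := normal_of (preim_is_normal f N).

Section QuotientFacts.
Variables (X : groupType) (N : normal_subgroup X).

Definition quot : hom X (quotient_group N) := @quotient_map X N.

Lemma quot_onto : onto quot.
Proof. by elim/quotW => x; exists x. Qed.

Lemma quot_eq x y : quot x = quot y <-> carrier N (x^-1 * y).
Proof.
split; last exact: coset_eq.
by move=> /eqmodP/asboolP.
Qed.

Lemma quot_eq1 x : quot x = 1 <-> carrier N x.
Proof.
rewrite -(hom1 quot) quot_eq mulg1; split=> /subgroupV; rewrite ?invgK //.
Qed.

End QuotientFacts.

Lemma hom_factor (X M Y : groupType) (g : hom X M) (h : hom X Y) :
  onto g -> (forall x, g x = 1 -> h x = 1) ->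
  exists k : hom M Y, forall x, k (g x) = h x.
Proof.
move=> g_onto gh; have [s sK] := choice g_onto.
have E x y : g x = g y -> h x = h y.
  move=> gxy; apply/divg1_eq; rewrite -homV -homM; apply: gh.
  by rewrite homM homV gxy mulgV.
have kM : {morph h \o s : a b / a * b}.
  by move=> a b /=; rewrite -homM; apply: E; rewrite homM !sK.
by exists (hom_of kM) => x; apply: E; rewrite sK.
Qed.

Lemma image_is_normal (X Y : groupType) (f : hom X Y) (N : normal_subgroup X) :
  onto f -> is_normal (f @` carrier N).
Proof.
move=> f_onto; split=> [|_ y [x Nx <-]]; last first.
  by have [z <-] := f_onto y; exists (x ^ z); [apply: nsubgroupJ | apply: gmulfJ].
by split; [apply: image_subgroup1 | apply: image_subgroupM | apply: image_subgroupV].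
Qed.

Definition image_normal (X Y : groupType) (f : hom X Y) (N : normal_subgroup X)
  (f_onto : onto f) : normal_subgroup Y := normal_of (image_is_normal N f_onto).

Section Cyclic.
Variables (X : groupType) (x : X).

Definition cyclic_set : set X := [set y | exists i j, y = x ^+ i * x ^- j].

Lemma commuteXXV i j : commute (x ^+ i) (x ^- j).
Proof. by apply/commuteV/commuteX2. Qed.

Lemma cyclic_is_subgroup : is_subgroup cyclic_set.
Proof.
split; first by exists 0, 0; rewrite mulgV.
- move=> _ _ [i [j ->]] [k [l ->]]; exists (i + k)%N, (j + l)%N.
  rewrite !expgnDr invgM -!mulgA; congr (_ * _).
  rewrite !mulgA -(commuteXXV k j) -!mulgA; congr (_ * _).
  by rewrite -!invgM -!expgnDr addnC.
- move=> _ [i [j ->]]; exists j, i.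
  by rewrite invgM invgK.
Qed.

Definition cyclic : subgroup X := subgroup_of cyclic_is_subgroup.

Lemma cyclic_id : carrier cyclic x.
Proof. by exists 1%N, 0%N; rewrite expg1 invg1 mulg1. Qed.

Lemma cyclic_commute y z : commute x z -> carrier cyclic y -> commute y z.
Proof.
move=> xz [i [j ->]]; apply/commute_sym/commuteM; first exact/commuteX.
by apply/commuteV/commuteX.
Qed.
End Cyclic.

Section CentralNormal.
Variables (X : groupType) (S : subgroup X) (cS : S `<=` center X).

Lemma central_subgroupJ x y : carrier S x -> carrier S (x ^ y).
Proof.
by move=> Sx; have -> : x ^ y = x by apply/conjg_fixP/commgP/cS.
Qed.

Definition central_normal : normal_subgroup X := NormalSubgroup central_subgroupJ.
End CentralNormal.

Section PowerLemmas.
Variable X : groupType.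
Implicit Types x y : X.

Lemma expg_coprime x m n : coprime m n -> x ^+ m = 1 -> x ^+ n = 1 -> x = 1.
Proof.
move=> /eqP cmn xm xn; case: (posnP m) => [m0|m_gt0].
  by move: cmn xn; rewrite m0 gcd0n => ->; rewrite expg1.
case: (egcdnP n m_gt0) => u v; rewrite cmn => e _.
have : x ^+ (u * m) = x ^+ (v * n + 1) by rewrite e.
by rewrite expgnDr (mulnC u) (mulnC v) !expgnA xm xn !expg1n mul1g expg1.
Qed.

Lemma expg_dvd x m n : (m %| n)%N -> x ^+ m = 1 -> x ^+ n = 1.
Proof. by case/dvdnP=> k -> xm; rewrite mulnC expgnA xm expg1n. Qed.

Lemma has_order_ex x n : (0 < n)%N -> x ^+ n = 1 -> exists m, has_order x m.
Proof.
move=> n0 xn.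
have ex : exists m, (0 < m)%N && (x ^+ m == 1) by exists n; rewrite n0 xn eqxx.
have := ex_minnP ex; case=> m /andP[m0 /eqP xm] min; exists m; split=> // k k0 xk.
by apply: min; rewrite k0 xk eqxx.
Qed.

End PowerLemmas.

(** * Closure of root classes, maximal normal subgroups, upper central series *)

Section RootClass.
Variables (C : group_class) (rC : root_class C).
Implicit Types X Y Z K W : groupType.

Lemma root_class_embed X Y (f : hom X Y) : injective f -> C Y -> C X.
Proof.
move=> f_inj CY.
have Sf x : carrier (range_subgroup f) (f x) by apply/range_subgroupP; exists x.
apply: (root_isomorphic rC) (root_subgroup rC (range_subgroup f) CY).
have onto_g : forall s : subgroup_group (range_subgroup f), exists x, f x = val s.
  by move=> s; apply/range_subgroupP/(subgroup_valP s).
have [g gK] := choice onto_g.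
have gM : {morph g : s t / s * t}.
  by move=> s t; apply: f_inj; rewrite homM !gK; apply: (homM (subgroup_val _)).
exists (hom_of gM); exists (corestrict Sf) => [s|x] /=.
  by apply: subgroup_val_inj; rewrite corestrictE gK.
by apply: f_inj; rewrite gK; apply: corestrictE.
Qed.

Lemma root_class_trivial X : (forall x : X, x = 1) -> C X.
Proof.
move=> X1; have [Z CZ _] := root_nontrivial rC.
by apply: (root_class_embed (f := hom_one X Z)) => // x y _; rewrite (X1 x) (X1 y).
Qed.

(** C is closed under extensions of a C-group by any group that embeds in a
    C-group; the kernel is given here by an injection rather than as a subgroup. *)
Lemma root_class_extension K X Y (k : hom K X) (f : hom X Y) :
  injective k -> (forall x, f x = 1 -> exists z, k z = x) -> C K -> C Y -> C X.
Proof.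
move=> k_inj exact_k CK CY; apply: (root_extension rC (N := kernel f)).
  have kP (s : subgroup_group (kernel f)) : exists z, k z = val s.
    have fs : f (subgroup_val _ s) = 1 := subgroup_valP s.
    exact: exact_k fs.
  have [g gK] := choice kP.
  have gM : {morph g : s t / s * t}.
    by move=> s t; apply: k_inj; rewrite homM !gK; apply: (homM (subgroup_val _)).
  apply: (root_class_embed (f := hom_of gM)) CK => s t /= gst.
  by apply: subgroup_val_inj; rewrite /= -!gK gst.
have [j jE] := hom_factor (h := f) (@quot_onto _ (kernel f)) (fun x => (quot_eq1 _ x).1).
apply: (root_class_embed (f := j)) CY.
apply: hom_inj => a; have [x <-] := quot_onto a.
by rewrite jE => fx; apply/quot_eq1.
Qed.

Lemma root_class_prod X Y : C X -> C Y -> C (X * Y)%type.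
Proof.
move=> CX CY; apply: (root_class_extension (k := hom_inl X Y) (f := hom_snd X Y)) => //.
  by move=> x y [].
by move=> [x y] /= ->; exists x.
Qed.

Lemma root_class_power X Y : C X -> C Y -> C (cartesian_product (fun _ : Y => X)).
Proof.
move=> CX CY; apply: (root_cartesian rC CX CY) => _.
by exists (hom_id X); exists id.
Qed.
End RootClass.

Section Monolith.
Variables (X : groupType) (x : X).

Definition monolithic (Y : groupType) (y : Y) : Prop :=
  forall N : normal_subgroup Y, (exists2 z, carrier N z & z <> 1) -> carrier N y.

Definition trivial_subgroup : normal_subgroup X := kernel (hom_id X).

Definition avoiding : Type := {N : normal_subgroup X | ~ carrier N x}.
Definition avoiding_le (M N : avoiding) : bool := `[< carrier (sval M) `<=` carrier (sval N) >].

Lemma chain_bound (x1 : x <> 1) (A : set avoiding) :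
  total_on A avoiding_le -> exists N, forall M, A M -> avoiding_le M N.
Proof.
move=> totA; case: (pselect (exists M, A M)) => [[M0 AM0]|A0]; last first.
  by exists (exist _ trivial_subgroup x1) => M AM; case: A0; exists M.
pose S : set X := [set y | exists2 M, A M & carrier (sval M) y].
have nS : is_normal S.
  split=> [|y z [M AM My]]; last by exists M => //; apply: nsubgroupJ.
  split=> [|y z [M AM My] [N AN Nz]|y [M AM My]].
  - by exists M0 => //; apply: subgroup1.
  - by case: (totA M N AM AN) => /asboolP sub;
      [exists N | exists M] => //; apply: subgroupM => //; apply: sub.
  - by exists M => //; apply: subgroupV.
pose N := normal_of nS.
have Nx : ~ carrier N x by move=> [M _]; apply: (svalP M).
exists (exist _ N Nx) => M AM; apply/asboolP => y My; by exists M.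
Qed.

(** A maximal normal subgroup among those avoiding x exists by Zorn's lemma; in
    the quotient by it, every non-trivial normal subgroup contains the image of
    x. *)
Lemma monolithic_quotient : x <> 1 ->
  exists (Y : groupType) (f : hom X Y), [/\ onto f, f x <> 1 & monolithic (f x)].
Proof.
move=> x1.
have [||A totA|[M Mx] maxM] := @ZL_preorder avoiding (exist _ trivial_subgroup x1) avoiding_le.
- by move=> N; apply/asboolP.
- move=> N M K /asboolP MN /asboolP NK; apply/asboolP.
  exact: subset_trans MN NK.
- exact: chain_bound.
exists (quotient_group M), (quot M); split; first exact: quot_onto.
  by move/quot_eq1.
move=> N [z Nz z1]; apply: contrapT => Nx.
pose K := preim_normal (quot M) N.
have MK : avoiding_le (exist _ M Mx) (exist _ K Nx : avoiding).
  by apply/asboolP => y My; rewrite /= (quot_eq1 M y).2 //; apply: subgroup1.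
have /asboolP KM := maxM _ MK.
have [t tz] := quot_onto z; apply: z1; rewrite -tz; apply/quot_eq1/KM.
by rewrite /= tz.
Qed.
End Monolith.

Section UpperCentral.
Variable X : groupType.

Definition next_central_set (N : normal_subgroup X) : set X :=
  [set x | forall y, carrier N [~ x, y]].

Lemma next_centralP (N : normal_subgroup X) x :
  next_central_set N x <-> forall y, commute (quot N x) (quot N y).
Proof.
split=> H y.
  by apply/commgP/eqP; rewrite -gmulfR; apply/quot_eq1/H.
by apply/quot_eq1; rewrite gmulfR; apply/eqP/commgP.
Qed.

Lemma next_central_is_normal (N : normal_subgroup X) :
  is_normal (next_central_set N).
Proof.
split; last first.
  move=> a b /next_centralP Na; apply/next_centralP => y.
  rewrite gmulfJ; have -> // : quot N a ^ quot N b = quot N a.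
  exact/conjg_fixP/commgP.
split=> [y|a b /next_centralP Na /next_centralP Nb|a /next_centralP Na].
- by rewrite comm1g; apply: subgroup1.
- apply/next_centralP => y.
  by rewrite homM; apply/commute_sym/commuteM; apply/commute_sym.
- apply/next_centralP => y.
  by rewrite homV; apply/commute_sym/commuteV/commute_sym.
Qed.

Definition next_central (N : normal_subgroup X) : normal_subgroup X :=
  normal_of (next_central_is_normal N).

Fixpoint upper_central n : normal_subgroup X :=
  if n is m.+1 then next_central (upper_central m) else trivial_subgroup X.

Definition nilpotent : Prop := exists n, forall x, carrier (upper_central n) x.
End UpperCentral.

Lemma upper_central_hom (X Y : groupType) (f : hom X Y) n x :
  onto f -> carrier (upper_central X n) x -> carrier (upper_central Y n) (f x).
Proof.
move=> f_onto; elim: n x => [|n IHn] x /=; first by move=> ->; apply: hom1.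
by move=> Ux y; have [z <-] := f_onto y; rewrite -gmulfR; apply: IHn.
Qed.

Lemma nilpotent_onto (X Y : groupType) (f : hom X Y) :
  onto f -> nilpotent X -> nilpotent Y.
Proof.
move=> f_onto [n Xn]; exists n => y; have [x <-] := f_onto y.
exact: upper_central_hom.
Qed.

Lemma upper_central_leq (X : groupType) m n x :
  (m <= n)%N -> carrier (upper_central X m) x -> carrier (upper_central X n) x.
Proof.
move/subnK <-; elim: (n - m)%N => // k IHk /IHk Ux y.
by rewrite commgEl; apply: subgroupM; [apply: subgroupV | apply: nsubgroupJ].
Qed.

Lemma nilpotent_prod (X Y : groupType) :
  nilpotent X -> nilpotent Y -> nilpotent (X * Y)%type.
Proof.
move=> [m Xm] [n Yn]; pose k := maxn m n.
have Xk x : carrier (upper_central X k) x by apply: upper_central_leq (Xm x); apply: leq_maxl.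
have Yk y : carrier (upper_central Y k) y by apply: upper_central_leq (Yn y); apply: leq_maxr.
exists k => -[x y]; move: (Xk x) (Yk y); move: k {Xk Yk} => k.
elim: k x y => [|k IHk] x y /=; first by move=> -> ->.
by move=> Ux Uy [u v]; apply: IHk; [apply: Ux | apply: Uy].
Qed.

Lemma commg_expgl (X : groupType) (x y : X) n :
  commute x [~ x, y] -> [~ x ^+ n, y] = [~ x, y] ^+ n.
Proof.
move=> xc; elim: n => [|n IHn]; first by rewrite comm1g.
rewrite expgS (expgS _ n) commgEl invgM conjMg.
have -> : x ^ y = x * [~ x, y] by rewrite commgEl mulVKg.
have -> : (x ^+ n) ^ y = x ^+ n * [~ x, y] ^+ n by rewrite -IHn commgEl mulVKg.
move: [~ x, y] xc {IHn} => c xc.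
rewrite -!mulgA mulKg !mulgA; congr (_ * _).
by rewrite -mulgA (commuteX n (commute_sym xc)) mulKg.
Qed.

(** For x in the (n+2)-nd term, [x, y] is central modulo the n-th one, so
    [x^e, y] and [x, y]^e agree there: an exponent of the centre is an exponent
    of every factor of the upper central series. *)
Lemma upper_central_exponent (X : groupType) e : (forall x, carrier (upper_central X 1) x -> x ^+ e = 1) ->
  forall n x, carrier (upper_central X n) x -> x ^+ (e ^ n) = 1.
Proof.
move=> Xe.
have step n x : carrier (upper_central X n.+1) x -> carrier (upper_central X n) (x ^+ e).
  elim: n x => [|n IHn] x; first exact: Xe.
  move=> Ux y; apply/quot_eq1; rewrite gmulfR homX.
  have Uc := (next_centralP _ _).1 (Ux y).
  rewrite commg_expgl; last by rewrite -gmulfR; apply/commute_sym/Uc.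
  by rewrite -gmulfR -homX; apply/quot_eq1/IHn/Ux.
elim=> [|n IHn] x; first by rewrite expn0 expg1.
by move=> /step /IHn; rewrite -expgnA -expnS.
Qed.

(** * Images of bounded nilpotent groups *)

Section PrimePowers.
Variables (p : nat) (p_pr : prime p).

Lemma prime_expg_eq (Y Z : groupType) (w : Y) (c : Z) a b :
  w ^+ p = 1 -> w <> 1 -> w ^+ a = w ^+ b -> c ^+ p = 1 -> c ^+ a = c ^+ b.
Proof.
move=> wp w1 + cp; wlog le_ab : a b / (a <= b)%N => [hwlog wab|wab].
  case/orP: (leq_total a b) => le; first exact: hwlog.
  by apply/esym/hwlog.
have w_ba : w ^+ (b - a) = 1 by rewrite expgnFr // wab mulgV.
have p_ba : (p %| b - a)%N.
  apply: contrapT => /negP; rewrite -prime_coprime // => cop; apply: w1.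
  exact: expg_coprime cop wp w_ba.
by rewrite -(subnKC le_ab) expgnDr (expg_dvd p_ba cp) mulg1.
Qed.

Lemma primary_exponent (Y : groupType) (y : Y) n : (0 < n)%N ->
  primary_component p y -> y ^+ n = 1 -> y ^+ (p ^ logn p n) = 1.
Proof.
move=> n0 [a ya] yn; have [m cop nE] := pfactor_coprime p_pr n0.
apply: (@expg_coprime _ _ (p ^ a) m); first exact: coprimeXl.
  by rewrite -expgnA mulnC expgnA ya expg1n.
by rewrite -expgnA mulnC -nE.
Qed.

Lemma prime_mul_ex k : ~~ (p %| k)%N -> exists u v, (u * k = v * p + 1)%N.
Proof.
move=> pk; have k0 : (0 < k)%N by case: k pk => //; rewrite dvdn0.
case: (egcdnP p k0) => u v e _; exists u, v; rewrite e; congr addn.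
by apply/eqP; rewrite -/(coprime _ _) coprime_sym prime_coprime.
Qed.

(** In the quotient by a maximal subgroup avoiding v, every non-trivial cyclic
    subgroup contains the image of v; so this image generates the quotient, and
    can be sent to c. *)
Lemma elementary_functional (V Z : groupType) (v : V) (c : Z) :
  abelian V -> (forall x : V, x ^+ p = 1) -> v <> 1 -> c ^+ p = 1 -> c <> 1 ->
  exists l : hom V Z, l v <> 1.
Proof.
move=> abV Vp v1 cp c1; have [Y [f [f_onto fv mono]]] := monolithic_quotient v1.
set w := f v in fv mono; have wp : w ^+ p = 1 by rewrite -homX Vp hom1.
have abY (x y : Y) : commute x y.
  have [a <-] := f_onto x; have [b <-] := f_onto y; exact: gmulf_commute.
have Yp (y : Y) : y ^+ p = 1.
  by have [a <-] := f_onto y; rewrite -homX Vp hom1.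
have gen (y : Y) : exists k, w ^+ k = y.
  have [->|/eqP y1] := eqVneq y 1; first by exists 0%N.
  have cent : cyclic y `<=` center Y by move=> z _ t; apply: abY.
  have [i [j wE]] : carrier (cyclic y) w.
    by apply: (mono (central_normal cent)); exists y => //; apply: cyclic_id.
  (* Inverses are removed using y^-1 = y^(p-1). *)
  have wk : w = y ^+ (i + p.-1 * j).
    rewrite wE expgnDr; congr (_ * _); apply: mulg1_eq.
    by rewrite -expgnDr -mulSn prednK ?prime_gt0 // expgnA Yp expg1n.
  move: (_ + _)%N wk => k wk.
  have pk : ~~ (p %| k)%N.
    by apply/negP=> /expg_dvd/(_ (Yp y)) yk; apply: fv; rewrite wk.
  have [u [r ur]] := prime_mul_ex pk; exists u.
  by rewrite wk -expgnA mulnC ur expgnDr mulnC expgnA Yp expg1n mul1g.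
have [g gK] := choice gen.
have gM : {morph (fun x => c ^+ g x) : x y / x * y}.
  move=> x y /=; rewrite -expgnDr.
  by apply: (prime_expg_eq wp fv) => //; rewrite expgnDr !gK.
exists (hom_comp (hom_of gM) f) => /=; rewrite -/w => cw; apply: c1.
by rewrite -[c]expg1 -cw; apply: (prime_expg_eq wp fv) => //; rewrite gK.
Qed.

Variables (C : group_class) (rC : root_class C).
Variables (Z : groupType) (c : Z) (CZ : C Z) (cp : c ^+ p = 1) (c1 : c <> 1).

(** The functionals separating the elements of V can be indexed by W, since V
    injects into W; together they embed V in a Cartesian power of Z over W.
    Indexing by the whole dual of V would need too large a power. *)
Lemma elementary_in_root_class (V W : groupType) (f : V -> W) :
  abelian V -> (forall x : V, x ^+ p = 1) -> injective f -> C W -> C V.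
Proof.
move=> abV Vp f_inj CW.
have ex w : exists l : hom V Z, forall v, f v = w -> v <> 1 -> l v <> 1.
  have [[v vw]|nv] := pselect (exists v, f v = w); last first.
    by exists (hom_one V Z) => v vw; case: nv; exists v.
  have [v1|/eqP v1] := eqVneq v 1.
    by exists (hom_one V Z) => u; rewrite -vw => /f_inj ->.
  have [l lv] := elementary_functional abV Vp v1 cp c1.
  by exists l => u; rewrite -vw => /f_inj ->.
have [l lP] := choice ex.
have LM : {morph (fun v => (fun w => l w v) : cartesian_product (fun _ : W => Z)) :
    x y / x * y}.
  by move=> x y; apply: functional_extensionality_dep => w; apply: homM.
apply: (root_class_embed rC (f := hom_of LM)); last exact: root_class_power.
apply: hom_inj => v Lv; apply: contrapT => v1; apply: (lP (f v) v erefl v1).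
exact: (congr1 (fun u : cartesian_product (fun _ : W => Z) => u (f v)) Lv).
Qed.

(** The map x |-> x^p has an elementary abelian kernel and an image of smaller
    exponent. *)
Lemma abelian_primary_in_root_class k (V W : groupType) (f : V -> W) :
  abelian V -> (forall x : V, x ^+ (p ^ k) = 1) -> injective f -> C W -> C V.
Proof.
move=> + + + CW; elim: k V f => [|k IHk] V f abV Vp f_inj.
  by apply: (root_class_trivial rC) => x; rewrite -(Vp x) expn0 expg1.
have pM : {morph (fun x : V => x ^+ p) : x y / x * y}.
  by move=> x y; apply: expgMn; apply: abV.
pose P := hom_of pM; pose R := range_subgroup P.
have PR x : carrier R (P x) by apply/range_subgroupP; exists x.
apply: (root_class_extension rC (k := subgroup_val (kernel P)) (f := corestrict PR)).
- exact: subgroup_val_inj.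
- move=> x Px1; have := corestrictE PR x; rewrite Px1 hom1 => /esym Px.
  by exists (@subgroup_mk _ (kernel P) x Px).
- apply: (elementary_in_root_class (f := f \o subgroup_val (kernel P))) CW.
  + by move=> x y; apply: subgroup_val_inj; rewrite !homM; apply: abV.
  + move=> x; apply: subgroup_val_inj; rewrite homX hom1; exact: (subgroup_valP x).
  + by move=> x y /f_inj/subgroup_val_inj.
- apply: (IHk _ (f \o subgroup_val R)).
  + by move=> x y; apply: subgroup_val_inj; rewrite !homM; apply: abV.
  + move=> x; apply: subgroup_val_inj; rewrite homX hom1.
    have /range_subgroupP[y <-] := subgroup_valP x.
    by rewrite hom_ofE -expgnA -expnS.
  + by move=> x y /f_inj/subgroup_val_inj.
Qed.
End PrimePowers.

Lemma primes_of_witness (C : group_class) p : primes_of C p ->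
  exists2 Z : groupType, C Z & exists2 c : Z, c ^+ p = 1 & c <> 1.
Proof.
move=> [p_pr [Z CZ [x [n [[n0 xn min] /dvdnP[m nE]]]]]].
exists Z => //; exists (x ^+ m); first by rewrite -expgnA -nE.
have m0 : (0 < m)%N by move: n0; rewrite nE muln_gt0 => /andP[].
move=> /(min _ m0); rewrite nE leqNgt => /negP; apply.
by rewrite -[X in (X < _)%N]muln1 ltn_pmul2l // prime_gt1.
Qed.

Section Tame.
Variables (C : group_class) (rC : root_class C).

Definition primary_bounded p (Y : groupType) : Prop :=
  (exists2 n, (0 < n)%N & forall y : Y, primary_component p y -> y ^+ n = 1) /\
  ((forall y : Y, primary_component p y) -> C Y).

(** The properties of bounded nilpotent groups that are needed, put on all
    homomorphic images at once. In this form they pass to quotients for free,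
    and to products by extension, without following central series. *)
Definition tame (X : groupType) : Prop :=
  forall p, primes_of C p -> forall (Y : groupType) (f : hom X Y),
    onto f -> primary_bounded p Y.

Lemma tame_onto (X Y : groupType) (f : hom X Y) : onto f -> tame X -> tame Y.
Proof.
move=> f_onto tX p Cp Z g g_onto; apply: (tX p Cp Z (hom_comp g f)) => z.
by have [y <-] := g_onto z; have [x <-] := f_onto y; exists x.
Qed.

Lemma primary_hom (X Y : groupType) (f : hom X Y) p x :
  primary_component p x -> primary_component p (f x).
Proof. by move=> [k xk]; exists k; rewrite -homX xk hom1. Qed.

Lemma primary_hom_inj (X Y : groupType) (f : hom X Y) p x :
  injective f -> primary_component p (f x) -> primary_component p x.
Proof. by move=> f_inj [k xk]; exists k; apply: f_inj; rewrite homX xk hom1. Qed.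

Lemma primary_bounded_ext p (Y : groupType) (N : normal_subgroup Y) :
  primary_bounded p (subgroup_group N) ->
  primary_bounded p (quotient_group N) -> primary_bounded p Y.
Proof.
move=> [[m m0 Nm] CN] [[n n0 Yn] CY]; split.
  exists (n * m)%N; first by rewrite muln_gt0 n0.
  move=> y py; have Ny : carrier N (y ^+ n).
    by apply/quot_eq1; rewrite homX; apply: Yn; apply: primary_hom.
  have := Nm (subgroup_mk Ny).
  move=> /(_ _)/(congr1 (subgroup_val N)); rewrite homX subgroup_mkK hom1 expgnA.
  apply; apply: (primary_hom_inj (@subgroup_val_inj _ N)); rewrite subgroup_mkK.
  by have [k yk] := py; exists k; rewrite expgnAC yk expg1n.
move=> pY; apply: (root_extension rC (N := N)); [apply: CN|apply: CY] => y.
  exact: (primary_hom_inj (@subgroup_val_inj _ N)).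
by have [x <-] := quot_onto y; apply: primary_hom.
Qed.

Lemma tame_prod (X1 X2 : groupType) : tame X1 -> tame X2 -> tame (X1 * X2)%type.
Proof.
move=> t1 t2 p Cp Y f f_onto.
have N_onto : onto (hom_snd X1 X2) by move=> x; exists (1, x).
pose N := image_normal (kernel (hom_snd X1 X2)) f_onto.
have lN x : carrier N (hom_comp f (hom_inl X1 X2) x) by exists (x, 1).
apply: (primary_bounded_ext (N := N)).
  apply: (t1 p Cp _ (corestrict lN)) => y.
  have [[x1 x2] x2E yE] := subgroup_valP y; exists x1.
  by apply: subgroup_val_inj; rewrite corestrictE -yE (x2E : x2 = 1).
have [k kE] : exists k : hom X2 (quotient_group N),
    forall x, k (hom_snd X1 X2 x) = hom_comp (quot N) f x.
  by apply: hom_factor => // x x2; apply/quot_eq1; exists x.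
apply: (t2 p Cp _ k) => y; have [z <-] := quot_onto y.
by have [x <-] := f_onto z; exists x.2; apply: kE.
Qed.

Lemma bounded_abelian_tame (A : groupType) : bounded_abelian C A -> tame A.
Proof.
move=> [abA bA] p Cp Y f f_onto.
have [k kE] := hom_factor (h := f) (@quot_onto _ (kernel f))
  (fun x => (quot_eq1 _ x).1).
have k_inj : injective k.
  apply: hom_inj => a; have [x <-] := quot_onto a.
  by rewrite kE => fx; apply/quot_eq1.
have k_onto : onto k by move=> y; have [x <-] := f_onto y; exists (quot _ x).
have [[n n0 An] [W CW /card_leP/injfunPex[g _ g_inj]]] := bA (kernel f) p Cp.
have Yn (y : Y) : primary_component p y -> y ^+ n = 1.
  have [a <-] := k_onto y => pa; rewrite -homX An ?hom1 //.
  exact: primary_hom_inj pa.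
split; first by exists n.
move=> pY; have p_pr : prime p by case: Cp.
have [Z CZ [c cp c1]] := primes_of_witness Cp.
have [h hK] := choice k_onto.
have ph y : h y \in primary_component (A := quotient_group (kernel f)) p.
  by apply/mem_set; apply: (primary_hom_inj k_inj); rewrite hK.
apply: (abelian_primary_in_root_class p_pr rC CZ cp c1 (k := logn p n)
  (f := fun y => val (g (SigSub (ph y)))) _ _ _ CW).
- move=> x y; have [a <-] := f_onto x; have [b <-] := f_onto y.
  exact: gmulf_commute.
- by move=> y; apply: primary_exponent => //; apply: Yn.
- move=> x y /val_inj gxy.
  have /(congr1 val) /= hxy := g_inj _ _ (mem_set I) (mem_set I) gxy.
  by rewrite -(hK x) -(hK y) hxy.
Qed.

(** For an image Y of X in which the term Z i of the series dies, the image of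
    Z i.+1 is normal in Y, is a quotient of the bounded abelian factor, and
    leaves a quotient in which Z i.+1 dies: the claim is proved by descending
    induction on i. *)
Lemma bounded_nilpotent_tame (X : groupType) : bounded_nilpotent C X -> tame X.
Proof.
move=> [n [Z [[Z0 Zn Zi] bZ]]] p Cp.
have main i : (i <= n)%N -> forall (Y : groupType) (f : hom X Y), onto f ->
    (forall x, carrier (Z (n - i)%N) x -> f x = 1) -> primary_bounded p Y.
  elim: i => [|i IHi] le_in Y f f_onto fZ.
    have Y1 (y : Y) : y = 1.
      by have [x <-] := f_onto y; apply: fZ; rewrite subn0 Zn.
    split; first by exists 1%N => // y _; rewrite expg1.
    by move=> _; apply: root_class_trivial Y1.
  (* Descending induction: the i of the induction counts the steps from the top. *)
  have lt_in : (n - i.+1 < n)%N by rewrite ltn_subrL (leq_ltn_trans _ le_in).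
  have jE : (n - i = (n - i.+1).+1)%N by rewrite subnSK.
  move: (n - i.+1)%N lt_in jE fZ => j lt_jn jE fZ.
  pose N := image_normal (Z j.+1) f_onto.
  have qf_onto : onto (hom_comp (quot N) f).
    by move=> y; have [z <-] := quot_onto y; have [x <-] := f_onto z; exists x.
  apply: (primary_bounded_ext (N := N)); last first.
    apply: (IHi (ltnW le_in) _ _ qf_onto) => x; rewrite jE => Zx.
    by apply/quot_eq1; exists x.
  have [k kE] : exists k : hom (quotient_group (Z j)) Y,
      forall x, k (quot (Z j) x) = f x.
    apply: hom_factor => [|x /quot_eq1]; [exact: quot_onto | exact: fZ].
  have kN s : carrier N (hom_comp k (subgroup_val (series_factor Z j)) s).
    have [x Zx xE] := subgroup_valP s.
    by exists x => //; rewrite -kE; apply: (congr1 k xE).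
  apply: (bounded_abelian_tame (bZ j lt_jn) Cp (f := corestrict kN)) => y.
  have [x Zx xE] := subgroup_valP y.
  have Sx : carrier (series_factor Z j) (quot (Z j) x) by exists x.
  exists (subgroup_mk Sx); apply: subgroup_val_inj.
  by rewrite corestrictE -xE /=; apply: kE.
move=> Y f f_onto; apply: (main n (leqnn n) Y f f_onto) => x.
by rewrite subnn Z0 => ->; apply: hom1.
Qed.

Lemma central_series_nilpotent (X : groupType) n (Z : nat -> normal_subgroup X) :
  central_series n Z -> nilpotent X.
Proof.
move=> [Z0 Zn Zi]; exists n => x.
have main i : (i <= n)%N -> carrier (Z i) `<=` carrier (upper_central X i).
  elim: i => [|i IHi] le_in; first by rewrite Z0.
  have [_ Zc] := Zi i le_in => y Zy z; apply: IHi; first exact: ltnW.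
  apply/quot_eq1; rewrite gmulfR; apply/eqP/commgP; apply: Zc.
  by exists y.
by apply: (main n (leqnn n)); rewrite Zn.
Qed.

Definition tame_nilpotent X := nilpotent X /\ tame X.

Lemma bounded_nilpotent_tame_nilpotent X : bounded_nilpotent C X -> tame_nilpotent X.
Proof.
move=> bX; split; last exact: bounded_nilpotent_tame.
by have [n [Z [cZ _]]] := bX; apply: central_series_nilpotent cZ.
Qed.
End Tame.

(** * Separating elements of bounded nilpotent groups *)

Section ResidualNilpotent.
Variables (C : group_class) (rC : root_class C).
Hypothesis C_periodic : forall X : groupType, C X -> periodic X.

(** The P(C)'-numbers. *)
Definition coprime_to_class (q : nat) : Prop :=
  (0 < q)%N /\ forall r, prime r -> (r %| q)%N -> ~ primes_of C r.

Lemma coprime_to_class1 : coprime_to_class 1.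
Proof. by split=> // r r_pr; rewrite dvdn1 => /eqP r1; rewrite r1 in r_pr. Qed.

Lemma coprime_to_classM m n :
  coprime_to_class m -> coprime_to_class n -> coprime_to_class (m * n).
Proof.
move=> [m0 Cm] [n0 Cn]; split; first by rewrite muln_gt0 m0.
by move=> r r_pr; rewrite Euclid_dvdM // => /orP[]; [apply: Cm | apply: Cn].
Qed.

Lemma primes_of_nonempty : exists p, primes_of C p.
Proof.
have [Z CZ [z z1]] := root_nontrivial rC.
have [n n0 zn] := C_periodic CZ z; have [m zm] := has_order_ex n0 zn.
have [m0 zm1 _] := zm; have m1 : (1 < m)%N.
  by case: m m0 zm1 {zm} => [|[|m]] //; rewrite expg1.
exists (pdiv m); split; first exact: pdiv_prime.
by exists Z => //; exists z, m; split=> //; apply: pdiv_dvd.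
Qed.

(** The cyclic subgroup of a non-trivial central element z is normal, so contains
    y, and so does that of every non-trivial power of z; hence z has p-power
    order. The centre then has bounded p-power exponent, which climbs the upper
    central series, and Y is a p-group, one of its own images to which tameness
    applies. *)
Lemma monolithic_in_class (Y : groupType) (y : Y) p : primes_of C p ->
  tame_nilpotent C Y -> y ^+ p = 1 -> y <> 1 -> monolithic y -> C Y.
Proof.
move=> Cp [[n Yn] tY] yp y1 mono; have p_pr : prime p by case: Cp.
have [[m m0 pm] CY] := tY p Cp Y (hom_id Y) (fun y => ex_intro _ y erefl).
have center_primary z : carrier (upper_central Y 1) z -> primary_component p z.
  move=> Uz; have [->|/eqP z1] := eqVneq z 1; first by exists 0%N.
  have zc u : commute z u by apply/commgP/eqP; apply: Uz.
  have mono_z w : (forall u, commute w u) -> w <> 1 -> carrier (cyclic w) y.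
    move=> wc w1; have cw : cyclic w `<=` center Y.
      by move=> v Cv u; apply: cyclic_commute (wc u) Cv.
    by apply: (mono (central_normal cw)); exists w => //; apply: cyclic_id.
  have [k k0 zk] : exists2 k, (0 < k)%N & z ^+ k = 1.
    have [i [j yE]] := mono_z z zc z1.
    have : z ^+ (i * p) = z ^+ (j * p).
      have := yp; rewrite yE expgnFl; last exact: commuteX2.
      by rewrite -!expgnA => /divg1_eq.
    wlog lt_ij : i j {yE} / (i < j)%N => [hwlog|] zE.
      case: (ltngtP i j) => [/hwlog/(_ zE)//|/hwlog/(_ (esym zE))//|ij].
      by case: y1; rewrite yE ij mulgV.
    exists (j * p - i * p)%N.
      by rewrite subn_gt0 ltn_pmul2r // prime_gt0.
    by rewrite expgnFr ?leq_pmul2r ?prime_gt0 ?(ltnW lt_ij) // zE mulgV.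
  have [l cop kE] := pfactor_coprime p_pr k0.
  (* k is p^a l with l prime to p: if z^(p^a) were non-trivial, y would be one of
     its powers, hence killed both by l and by p. *)
  exists (logn p k); apply: contrapT => w1.
  have [i [j yE]] := mono_z _ (fun u => commute_sym (commuteX _ (commute_sym (zc u)))) w1.
  have wl : (z ^+ (p ^ logn p k)%N) ^+ l = 1 by rewrite -expgnA mulnC -kE.
  apply: y1; apply: (expg_coprime (m := p) (n := l)) => //.
  rewrite yE expgnFl; last exact: commuteX2.
  by rewrite expgnAC wl expg1n (expgnAC _ j) wl expg1n invg1 mulg1.
have Ye x : carrier (upper_central Y 1) x -> x ^+ (p ^ logn p m) = 1.
  by move=> /center_primary px; apply: primary_exponent => //; apply: pm.
apply: CY => x; exists (logn p m * n)%N; rewrite expnM.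
exact: (upper_central_exponent Ye).
Qed.

(** If y were in the subgroup generated by y^p for all p in P(C), then y would
    have finite order, not divisible by any p in P(C). *)
Lemma central_avoids_power (Y : groupType) (y : Y) :
  (forall q, coprime_to_class q -> y ^+ q <> 1) ->
  exists2 p, primes_of C p & ~ carrier (cyclic (y ^+ p)) y.
Proof.
move=> yq; apply: contrapT => nex.
have in_cyclic p : primes_of C p -> exists i j, y ^+ (1 + p * j) = y ^+ (p * i).
  move=> Cp; have [i [j yE]] : carrier (cyclic (y ^+ p)) y.
    by apply: contrapT => ny; apply: nex; exists p.
  by exists i, j; rewrite expgnDr {1}expg1 {1}yE !expgnA mulgVK.
have [n n0 yn] : exists2 n, (0 < n)%N & y ^+ n = 1.
  have [p Cp] := primes_of_nonempty; have [i [j yij]] := in_cyclic p Cp.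
  have p_pr : prime p by case: Cp.
  have ne : (1 + p * j != p * i)%N.
    apply/eqP => e; have : (p %| 1)%N.
      by rewrite -(dvdn_addl 1 (dvdn_mulr j (dvdnn p))) e dvdn_mulr.
    by rewrite dvdn1 => /eqP p1; rewrite p1 in p_pr.
  move: (1 + _)%N (p * i)%N ne yij => a b; wlog: a b / (a < b)%N => [hwlog ne yab|].
    by case: (ltngtP a b) ne => // lt _; [apply: (hwlog a b) | apply: (hwlog b a)];
      rewrite ?ltn_eqF // ?yab.
  move=> lt_ab _ yab; exists (b - a)%N; first by rewrite subn_gt0.
  by rewrite expgnFr ?(ltnW lt_ab) // yab mulgV.
have [m ym] := has_order_ex n0 yn; have [m0 ym1 min] := ym.
apply: (yq m) => //; split=> // r r_pr /dvdnP[k mE] Cr.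
have [i [j yij]] := in_cyclic r Cr.
have k0 : (0 < k)%N by move: m0; rewrite mE muln_gt0 => /andP[].
have yk : y ^+ k = 1.
  have := congr1 (fun z => z ^+ k) yij; rewrite -!expgnA.
  have -> : ((1 + r * j) * k = k + m * j)%N.
    by rewrite mulnDl mul1n mE; congr addn; rewrite mulnC mulnA.
  have -> : (r * i * k = m * i)%N by rewrite mE mulnC mulnA.
  by rewrite expgnDr !(expgnA _ m) ym1 !expg1n mulg1.
have := min k k0 yk; rewrite mE leqNgt => /negP; apply.
by rewrite -[X in (X < _)%N]muln1 ltn_pmul2l // prime_gt1.
Qed.

Lemma tame_nilpotent_onto (X Y : groupType) (f : hom X Y) :
  onto f -> tame_nilpotent C X -> tame_nilpotent C Y.
Proof.
by move=> f_onto [nX tX]; split; [apply: nilpotent_onto nX | apply: tame_onto tX].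
Qed.

Lemma tame_nilpotent_prod (X Y : groupType) :
  tame_nilpotent C X -> tame_nilpotent C Y -> tame_nilpotent C (X * Y)%type.
Proof.
by move=> [nX tX] [nY tY]; split; [apply: nilpotent_prod | apply: tame_prod].
Qed.

(** Take the lowest term of the upper central series containing a P(C)'-power of
    x. One step below it, this power y is central with no trivial P(C)'-power;
    dividing by y^p for a suitable p in P(C), y becomes an element of order p,
    and survives in a quotient by a maximal normal subgroup avoiding it. *)
Lemma tame_nilpotent_separates (X : groupType) (x : X) : tame_nilpotent C X ->
  (forall q, coprime_to_class q -> x ^+ q <> 1) ->
  exists2 Y : groupType, C Y & exists f : hom X Y, f x <> 1.
Proof.
move=> tX xq; have [[n Xn] _] := tX.
pose lvl i := `[< exists2 q, coprime_to_class q & carrier (upper_central X i) (x ^+ q) >].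
have ex : exists i, lvl i.
  by exists n; apply/asboolP; exists 1%N => //; apply: coprime_to_class1.
case: (ex_minnP ex) => -[|j] /asboolP[q Cq Uq] min; first by case: (xq q).
pose f1 := quot (upper_central X j); pose y := f1 (x ^+ q).
have yc u : commute y u.
  have [t <-] := quot_onto u; apply/commgP/eqP; rewrite -gmulfR.
  by apply/quot_eq1/Uq.
have yq r : coprime_to_class r -> y ^+ r <> 1.
  move=> Cr; rewrite /y -homX -expgnA => /quot_eq1 Ur.
  have : lvl j by apply/asboolP; exists (q * r)%N => //; apply: coprime_to_classM.
  by move/min; rewrite ltnn.
have [p Cp yp] := central_avoids_power yq.
have cyp : cyclic (y ^+ p) `<=` center _.
  move=> v Cv u; apply: cyclic_commute Cv.
  exact/commute_sym/commuteX/commute_sym.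
pose f2 := quot (central_normal cyp).
have f2y : f2 y <> 1 by move/quot_eq1.
have [Y [f3 [f3_onto f3y mono]]] := monolithic_quotient f2y.
pose f := hom_comp f3 (hom_comp f2 f1).
have f_onto : onto f.
  move=> u; have [v <-] := f3_onto u; have [w <-] := quot_onto v.
  by have [t <-] := quot_onto w; exists t.
exists Y; last first.
  by exists f => fx; apply: f3y; rewrite -[f3 _]/(f _) homX fx expg1n.
apply: (monolithic_in_class Cp (y := f3 (f2 y))) => //.
  exact: tame_nilpotent_onto tX.
rewrite -homX -[RHS](hom1 f3) -homX; congr (f3 _).
by apply/quot_eq1/cyclic_id.
Qed.
End ResidualNilpotent.

(** * Twisted homomorphisms and alternating words *)

Section Wreath.
Variables Z Q : groupType.

(** The unrestricted wreath product of Z by Q, acting on functions by right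
    translation of the argument. *)
Definition wreath_sort : Type := ((Q -> Z) * Q)%type.
HB.instance Definition _ := gen_eqMixin wreath_sort.
HB.instance Definition _ := gen_choiceMixin wreath_sort.

Definition wreath_mul (u v : wreath_sort) : wreath_sort :=
  (fun q => u.1 q * v.1 (q * u.2), u.2 * v.2).
Definition wreath_one : wreath_sort := (fun=> 1, 1).
Definition wreath_inv (u : wreath_sort) : wreath_sort :=
  (fun q => (u.1 (q * u.2^-1))^-1, u.2^-1).

Lemma wreath_mulA : associative wreath_mul.
Proof.
move=> u v w; congr pair; last exact: mulgA.
by apply: functional_extensionality_dep => q /=; rewrite !mulgA.
Qed.
Lemma wreath_mul1 : left_id wreath_one wreath_mul.
Proof.
move=> [u a]; congr pair; last exact: mul1g.
by apply: functional_extensionality_dep => q /=; rewrite mul1g mulg1.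
Qed.
Lemma wreath_mulg1 : right_id wreath_one wreath_mul.
Proof.
move=> [u a]; congr pair; last exact: mulg1.
by apply: functional_extensionality_dep => q /=; rewrite mulg1.
Qed.
Lemma wreath_mulV : left_inverse wreath_one wreath_inv wreath_mul.
Proof.
move=> [u a]; congr pair; last exact: mulVg.
by apply: functional_extensionality_dep => q /=; rewrite mulVg.
Qed.
Lemma wreath_mulgV : right_inverse wreath_one wreath_inv wreath_mul.
Proof.
move=> [u a]; congr pair; last exact: mulgV.
by apply: functional_extensionality_dep => q /=; rewrite mulgK mulgV.
Qed.

HB.instance Definition _ := isGroup.Build wreath_sort
  wreath_mulA wreath_mul1 wreath_mulg1 wreath_mulV wreath_mulgV.

Definition wreath : groupType := wreath_sort.

Lemma wreath_mulE (u v : wreath) :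
  u * v = (fun q => u.1 q * v.1 (q * u.2), u.2 * v.2) :> wreath.
Proof. by []. Qed.

Definition wreath_proj : hom wreath Q :=
  @hom_of wreath Q (fun u => u.2) (fun _ _ => erefl).

Lemma wreath_base_morph :
  {morph (fun f : cartesian_product (fun _ : Q => Z) => (f, 1) : wreath) : f g / f * g}.
Proof.
move=> f g; rewrite wreath_mulE /= mulg1; congr pair.
by apply: functional_extensionality_dep => q; rewrite mulg1.
Qed.
Definition wreath_base : hom (cartesian_product (fun _ : Q => Z)) wreath :=
  hom_of wreath_base_morph.

Lemma wreath_top_morph : {morph (fun q : Q => (fun=> 1, q) : wreath) : q r / q * r}.
Proof.
move=> q r; rewrite wreath_mulE /=; congr pair.
by apply: functional_extensionality_dep => s; rewrite mulg1.
Qed.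
Definition wreath_top : hom Q wreath := hom_of wreath_top_morph.

Lemma root_class_wreath (C : group_class) : root_class C -> C Z -> C Q -> C wreath.
Proof.
move=> rC CZ CQ; apply: (root_class_extension rC (k := wreath_base) (f := wreath_proj)) => //.
- by move=> f g [].
- by move=> [f q] /= ->; exists f.
- exact: root_class_power.
Qed.
End Wreath.

Definition separated (C : group_class) (P : groupType) (S : set P) (x : P) : Prop :=
  exists2 Q : groupType, C Q & exists f : hom P Q, ~ (f @` S) (f x).

Lemma separated_sub (C : group_class) (P : groupType) (S T : set P) (x : P) :
  S `<=` T -> separated C T x -> separated C S x.
Proof.
move=> ST [Q CQ [f fx]]; exists Q => //; exists f; apply: contra_not fx.
exact: image_subset.
Qed.

Lemma separated_seq (C : group_class) (rC : root_class C) (P : groupType)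
    (S : set P) (xs : seq P) :
  {in xs, forall x, separated C S x} ->
  exists2 Q : groupType, C Q &
    exists f : hom P Q, {in xs, forall x, ~ (f @` S) (f x)}.
Proof.
elim: xs => [_|x xs IHxs sep].
  have [Z CZ _] := root_nontrivial rC; exists Z => //.
  by exists (hom_one P Z).
have [|Q1 CQ1 [f1 f1P]] := IHxs.
  by move=> y y_xs; apply: sep; rewrite inE y_xs orbT.
have [|Q2 CQ2 [f2 f2P]] := sep x; first by rewrite inE eqxx.
exists (Q2 * Q1)%type; first exact: root_class_prod.
exists (hom_pair f2 f1) => y; rewrite inE => /orP[/eqP->|y_xs] [s Ss [e1 e2]].
  by apply: f2P; exists s.
by apply: (f1P y y_xs); exists s.
Qed.

Section Amalgam.
Variables (P : groupType) (side : bool -> set P) (H : subgroup P).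

(** The part of the universal property of an amalgam that the argument needs: a
    homomorphism may be conjugated on one factor by an element centralising the
    image of the amalgamated subgroup. *)
Definition twistable : Prop :=
  forall (t : bool) (R : groupType) (s : hom P R) (d : R),
  (forall h, carrier H h -> commute d (s h)) ->
  exists r : hom P R,
    [/\ forall a, side t a -> r a = s a,
        forall b, side (~~ t) b -> r b = s b ^ d &
        forall (R' : groupType) (g : hom R R'), g d = 1 ->
          forall x, g (r x) = g (s x)].

Fixpoint alternating (t : bool) (xs : seq P) : Prop :=
  if xs is x :: xs' then
    [/\ side t x, ~ carrier H x & alternating (~~ t) xs']
  else True.

Lemma alternating_nth t xs i : alternating t xs -> (i < size xs)%N ->
  side (t (+) odd i) (nth 1 xs i).
Proof.
elim: xs t i => [|x xs IHxs] t [|i] //= [tx _ alt] lt_i; first by rewrite addbF.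
by have := IHxs _ _ alt lt_i; rewrite addNb addbN.
Qed.

Hypothesis side_twist : twistable.
Hypothesis H_side : forall t, carrier H `<=` side t.
Variables (C : group_class) (rC : root_class C).

Section Step.
Variables (Q : groupType) (s : hom P Q).
Variables (Z : groupType) (c : Z) (c1 : c <> 1).

Definition indicator (q : Q) : Z :=
  if `[< (s @` carrier H) q >] then c else 1.

Lemma indicator1 : indicator 1 = c.
Proof.
rewrite /indicator asboolT //; exists 1; [exact: subgroup1 | exact: hom1].
Qed.

Lemma indicator_out q : ~ (s @` carrier H) q -> indicator q = 1.
Proof. by move=> Hq; rewrite /indicator asboolF. Qed.

(** This invariance is what makes the indicator function commute with s(H) in the
    wreath product. *)
Lemma indicatorM q h : carrier H h -> indicator (q * s h) = indicator q.
Proof.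
move=> Hh; rewrite /indicator; congr (if _ then _ else _).
apply: asbool_equiv_eq; split=> -[g Hg gE].
  exists (g * h^-1); first by apply: subgroupM => //; apply: subgroupV.
  by rewrite homM homV gE mulgK.
by exists (g * h); [apply: subgroupM | rewrite homM gE].
Qed.

Lemma image_H_inv q : (s @` carrier H) q^-1 -> (s @` carrier H) q.
Proof.
move=> [h Hh hE]; exists h^-1; first exact: subgroupV.
by rewrite homV hE invgK.
Qed.

(** The first components are the crossing records of single letters: none on the
    side t, and minus the coset left plus the coset reached on the other side. *)
Lemma twist_step t : exists r : hom P (wreath Z Q),
  [/\ forall x, (r x).2 = s x,
      forall a, side t a -> (r a).1 = fun=> 1 &
      forall b, side (~~ t) b ->
        (r b).1 = fun q => (indicator q)^-1 * indicator (q * s b)].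
Proof.
pose d : wreath Z Q := (indicator, 1).
have [|r [rA rB rg]] := @side_twist t _ (hom_comp (wreath_top Z Q) s) d.
  move=> h Hh; rewrite /commute !wreath_mulE /= mulg1 mul1g; congr pair.
  by apply: functional_extensionality_dep => q; rewrite mulg1 mul1g indicatorM.
exists r; split.
- by move=> x; have := rg Q (wreath_proj Z Q) erefl x.
- by move=> a /rA ->.
- move=> b /rB ->; rewrite conjgE !wreath_mulE /=.
  by apply: functional_extensionality_dep => q; rewrite invg1 !mulg1 mul1g.
Qed.

End Step.

Section Word.
Variables (t0 : bool) (xs : seq P).
Hypothesis xs_alt : alternating t0 xs.

Definition prefix_prod i := \prod_(x <- take i xs) x.
Local Notation g := prefix_prod.

Lemma prefix_prodS i : (i < size xs)%N -> g i.+1 = g i * nth 1 xs i.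
Proof.
by move=> lt_i; rewrite /g (take_nth 1 lt_i) -cats1 big_cat big_seq1.
Qed.

(** Within k letters the path of the word through the cosets of s(H) never
    returns to a coset it has visited. *)
Definition spread (k : nat) (Q : groupType) (s : hom P Q) : Prop :=
  forall i j, (i < j <= size xs)%N -> (j - i <= k)%N ->
    ~ (s @` carrier H) (s ((g i)^-1 * g j)).

(** Evaluate the record of the subword from i to j at the coset reached after its
    first letter. Of the two letters adjacent to this coset exactly one lies on
    the recorded side, and no other letter of the subword touches the coset, as
    these are at most k letters away. So the record of the subword is
    non-trivial, whereas elements of the side t have a trivial record. *)
Lemma spread_step (t : bool) k (Q : groupType) (s : hom P Q) :
  C Q -> (0 < k)%N -> spread k s ->
  exists2 R : groupType, C R & exists r : hom P R,
    [/\ spread k r,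
        forall i j, (i.+1 < j <= size xs)%N -> (j - i <= k.+1)%N ->
          ~ (r @` side t) (r ((g i)^-1 * g j)) &
        forall b, side (~~ t) b -> ~ (s @` carrier H) (s b) ->
          ~ (r @` side t) (r b)].
Proof.
move=> CQ k0 sk; have [Z CZ [c c1]] := root_nontrivial rC.
have [r [r2 rA rB]] := twist_step s c t.
exists (wreath Z Q); first exact: root_class_wreath.
have rM x y q : (r (x * y)).1 q = (r x).1 q * (r y).1 (q * s x).
  by rewrite homM wreath_mulE /= r2.
exists r; split.
- move=> i j ij le_k [h Hh hE]; apply: (sk i j ij le_k); exists h => //.
  by rewrite -!r2 hE.
- move=> i j /andP[lt_ij le_j] le_k [a Aa aE].
  have lt_i : (i.+1 < size xs)%N := leq_trans lt_ij le_j.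
  have lt_i' : (i < size xs)%N := ltnW lt_i.
  (* Right translation by q brings the coset reached after the letter i to s(H). *)
  pose q := s ((g i.+1)^-1 * g i).
  suff : (r ((g i)^-1 * g j)).1 q <> 1 by rewrite -aE rA.
  have qg m : q * s ((g i)^-1 * g m) = s ((g i.+1)^-1 * g m).
    by rewrite /q -homM mulgA mulgK.
  (* Letters after the first two meet only cosets at distance between 1 and k from
     the one where the record is evaluated. *)
  have tail m : (i.+2 + m <= size xs)%N -> (m < k)%N ->
      (r ((g i)^-1 * g (i.+2 + m)%N)).1 q = (r ((g i)^-1 * g i.+2)).1 q.
    elim: m => [|m IHm]; rewrite ?addn0 // addnS => le_m lt_mk.
    rewrite -(IHm (ltnW le_m) (ltnW lt_mk)) prefix_prodS // mulgA rM qg.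
    have out1 : indicator s c (s ((g i.+1)^-1 * g (i.+2 + m)%N)) = 1.
      apply/indicator_out/sk; first by rewrite leq_addr ltnW.
      by rewrite addSnnS addKn ltnW.
    have out2 : indicator s c (s ((g i.+1)^-1 * g (i.+2 + m).+1)) = 1.
      apply/indicator_out/sk; first by rewrite !ltnS ltnW ?leq_addr.
      by rewrite subSS 2!addSnnS addKn.
    move: (i.+2 + m)%N le_m out1 out2 => l le_l out1 out2.
    suff -> : (r (nth 1 xs l)).1 (s ((g i.+1)^-1 * g l)) = 1 by rewrite mulg1.
    have := alternating_nth xs_alt le_l.
    have [->|->] : (t0 (+) odd l = t) \/ (t0 (+) odd l = ~~ t).
    - by case: (_ (+) _) (t) => -[]; [left|right|right|left].
    - by move/rA=> ->.
    move/rB=> ->.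
    by rewrite -homM -mulgA -prefix_prodS // out1 out2 invg1 mulg1.
  have -> : j = (i.+2 + (j - i.+2))%N by rewrite subnKC.
  rewrite tail ?subnKC //; last by rewrite ltn_subLR // addSnnS -leq_subLR.
  rewrite !prefix_prodS // -mulgA mulKg rM.
  have qi : q * s (nth 1 xs i) = 1.
    by rewrite /q -homM -mulgA -prefix_prodS // mulVg hom1.
  have out i' : (i' < size xs)%N -> ~ (s @` carrier H) (s (nth 1 xs i')).
    move=> lt_i2; rewrite -[nth _ _ _](mulKg (g i')) -prefix_prodS //.
    by apply: sk; rewrite ?ltnSn // subSnn.
  rewrite qi; have := alternating_nth xs_alt lt_i; have := alternating_nth xs_alt lt_i'.
  rewrite /= addbN; have [->|->] : (t0 (+) odd i = t) \/ (t0 (+) odd i = ~~ t).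
  - by case: (_ (+) _) (t) => -[]; [left|right|right|left].
  - move=> /rA -> /rB ->; rewrite mul1g indicator1 mul1g indicator_out; last exact: out.
    by rewrite mulg1 => /eqP; rewrite invg_eq1 => /eqP.
  - rewrite negbK => /rB -> /rA ->; rewrite qi indicator1 mulg1 indicator_out; last first.
      move=> Hq; apply: (out i lt_i'); rewrite -(mulg1_eq qi).
      by apply: image_H_inv; rewrite invgK.
    by rewrite invg1 mul1g.
- move=> b Bb Hb [a Aa aE]; have : (r b).1 1 = 1 by rewrite -aE rA.
  rewrite rB // indicator1 mul1g indicator_out // mulg1.
  by move/eqP; rewrite invg_eq1 => /eqP.
Qed.

(** A word can only be separated from the side t if it does not lie there for a
    trivial reason, that is, if it is not a single letter on this side. *)
Lemma alternating_separated (t : bool) :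
  {in xs, forall x, separated C (carrier H) x} ->
  (1 < size xs)%N \/ size xs = 1%N /\ t0 = ~~ t ->
  separated C (side t) (\prod_(x <- xs) x).
Proof.
move=> sepH long; have [Q0 CQ0 [s0 s0P]] := separated_seq rC sepH.
have main k : exists2 Q : groupType, C Q & exists s : hom P Q, spread k.+1 s.
  elim: k => [|k [Q CQ [s sk]]].
    exists Q0 => //; exists s0 => i j /andP[lt_ij le_j].
    rewrite leq_subLR addn1 => le_ji; have -> : j = i.+1.
      by apply/eqP; rewrite eqn_leq le_ji.
    have lt_i := leq_trans lt_ij le_j.
    by rewrite prefix_prodS // mulKg; apply/s0P/mem_nth.
  have [R CR [r [rk r_far _]]] := spread_step t CQ (ltn0Sn k) sk.
  exists R => //; exists r => i j ij; rewrite leq_eqVlt => /orP[/eqP ji|lt_k].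
    have [lt_ij le_j] := andP ij.
    have ij' : (i.+1 < j <= size xs)%N.
      rewrite le_j andbT -(subnKC (ltnW lt_ij)) ji -addn2.
      by rewrite leq_add2l.
    by apply: contra_not (r_far i j ij' (eq_leq ji)); apply: image_subset.
  exact: rk ij lt_k.
have gE : \prod_(x <- xs) x = (g 0)^-1 * g (size xs).
  by rewrite /g take0 take_size big_nil invg1 mul1g.
have [Q CQ [s sk]] := main (size xs).
have [R CR [r [_ r_far r_out]]] := spread_step t CQ (ltn0Sn _) sk.
exists R => //; exists r; case: long => [lt1|[sz1 tE]].
  rewrite gE; apply: r_far; first by rewrite lt1 leqnn.
  by rewrite subn0 leqW // leqW.
have lt0 : (0 < size xs)%N by rewrite sz1.
rewrite gE sz1 prefix_prodS // mulKg; apply: r_out.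
  by have := alternating_nth xs_alt lt0; rewrite addbF tE.
have -> : nth 1 xs 0 = (g 0)^-1 * g 1 by rewrite prefix_prodS // mulKg.
by apply: sk; rewrite ?subn0.
Qed.
End Word.
End Amalgam.

Lemma twistable_sub (P : groupType) (side side' : bool -> set P) (H : subgroup P) :
  (forall t, side' t `<=` side t) -> twistable side H -> twistable side' H.
Proof.
move=> sub tw t R s d dH; have [r [rA rB rg]] := tw t R s d dH.
by exists r; split=> // x /sub; [apply: rA | apply: rB].
Qed.

Section NormalForm.
Variables (P : groupType) (side : bool -> subgroup P) (H : subgroup P).
Hypothesis H_side : forall t, carrier H `<=` carrier (side t).
Local Notation alt := (alternating (fun t => carrier (side t)) H).

Definition normal_form (x : P) : Prop :=
  carrier H x \/
  exists t xs, [/\ alt t xs, xs <> [::] & x = \prod_(y <- xs) y].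

Lemma subgroupMl (S : subgroup P) x y :
  carrier S x -> carrier S (x * y) -> carrier S y.
Proof.
by move=> Sx Sxy; rewrite -(mulKg x y); apply: subgroupM => //; apply: subgroupV.
Qed.

Lemma normal_formH h x : carrier H h -> normal_form x -> normal_form (h * x).
Proof.
move=> Hh [Hx|[t [[|y xs] [//= [ty Hy alt_xs] _ ->]]]].
  by left; apply: subgroupM.
right; exists t, (h * y :: xs); split=> //=; last by rewrite !big_cons mulgA.
split=> //; first by apply: subgroupM => //; apply: H_side.
by apply: contra_not Hy; apply: subgroupMl.
Qed.

Lemma normal_formM t y x : carrier (side t) y -> normal_form x -> normal_form (y * x).
Proof.
move=> ty; have [Hy|Hy] := pselect (carrier H y); first exact: normal_formH.
move=> [Hx|[t' [[|z xs] [//= [tz Hz alt_xs] _ ->]]]].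
  right; exists t, [:: y * x]; split=> //=; last by rewrite big_seq1.
  split=> //; first by apply: subgroupM => //; apply: H_side.
  move=> Hyx; apply: Hy; rewrite -(mulgK x y).
  by apply: subgroupM => //; apply: subgroupV.
have [tE|tE] : t' = ~~ t \/ t' = t by case: (t') (t) => -[]; auto.
  right; exists t, [:: y, z & xs]; split=> //=; last by rewrite !big_cons.
  by split=> //; rewrite -tE.
rewrite tE in tz alt_xs; have tyz : carrier (side t) (y * z) by apply: subgroupM.
rewrite big_cons mulgA; have [Hyz|Hyz] := pselect (carrier H (y * z)).
  apply: normal_formH => //; case: xs alt_xs => [|w xs] alt_xs.
    by left; rewrite big_nil; apply: subgroup1.
  by right; exists (~~ t), (w :: xs).
by right; exists t, (y * z :: xs); split=> //=; rewrite big_cons.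
Qed.

Lemma normal_form_prod ys :
  {in ys, forall y, exists t, carrier (side t) y} -> normal_form (\prod_(y <- ys) y).
Proof.
elim: ys => [_|y ys IHys ys_side].
  by left; rewrite big_nil; apply: subgroup1.
have [t ty] := ys_side y (mem_head _ _); rewrite big_cons.
apply: normal_formM ty _; apply: IHys => z z_ys.
by apply: ys_side; rewrite inE z_ys orbT.
Qed.
End NormalForm.

(** * Growing a tree edge by edge *)

Section TreeGrowth.
Variables (Gamma : finite_graph) (Gamma_tree : is_tree Gamma).
Local Notation V := (vertex Gamma).
Local Notation E := (edge Gamma).

Lemma tree_no_loop (e : E) (eps : bool) : ends e eps != ends e (~~ eps).
Proof.
have loop : ends e true != ends e false.
  apply/negP=> /eqP e_loop; have [_ /(_ [:: (e, true)])/negP[]] := Gamma_tree.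
  by rewrite /circuit /= /terminus /origin /= e_loop eqxx.
by case: eps; rewrite // eq_sym.
Qed.

Definition adjacent_without (e : E) : rel V := fun u v =>
  [exists e' : E, exists eps : bool,
    [&& e' != e, ends e' eps == u & ends e' (~~ eps) == v]].

(** A path of vertices only asserts that joining edges exist; circuits require
    them to be chosen. *)
Lemma path_edges e x p : path (adjacent_without e) x p ->
  exists os : seq (E * bool),
    [/\ map (@origin Gamma) os = belast x p, map (@terminus Gamma) os = p &
        e \notin map fst os].
Proof.
elim: p x => [|y p IHp] x /=; first by exists [::].
move=> /andP[/existsP[e' /existsP[eps /and3P[ne /eqP ox /eqP ty]]] /IHp[os [oE tE eos]]].
exists ((e', eps) :: os); split; rewrite /= ?oE ?tE.
- by rewrite -ox.
- by rewrite -ty.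
- by rewrite inE negb_or eos andbT eq_sym.
Qed.

Lemma path_edges_uniq x p (os : seq (E * bool)) :
  map (@origin Gamma) os = belast x p -> map (@terminus Gamma) os = p ->
  uniq (x :: p) -> uniq (map fst os).
Proof.
elim: os x p => [|o os IHos] x [|y p] //= [ox oE] [ty tE] /andP[x_p yp_uniq].
rewrite (IHos y p) // andbT; apply/negP=> /mapP[o' o'_os oo'].
move: x_p; rewrite -ox /origin oo' => /negP; apply.
have : origin o' \in y :: p by rewrite mem_belast // -oE map_f.
have : terminus o' \in y :: p by rewrite inE -[in X in _ || X]tE map_f ?orbT.
by rewrite /origin /terminus; case: (o.2) (o'.2) => -[].
Qed.

Lemma path_edges_path o0 x p (os : seq (E * bool)) :
  terminus o0 = x ->
  map (@origin Gamma) os = belast x p -> map (@terminus Gamma) os = p ->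
  path (fun o o' => terminus o == origin o') o0 os /\ terminus (last o0 os) = last x p.
Proof.
elim: os o0 x p => [|o os IHos] o0 x [|y p] //= t0 [ox oE] [ty tE].
by rewrite t0 ox eqxx; apply: IHos.
Qed.

(** A path joining the ends of e without using e would close up with e to a
    circuit. *)
Lemma tree_edge_separates (e : E) (eps : bool) :
  ~~ connect (adjacent_without e) (ends e (~~ eps)) (ends e eps).
Proof.
apply/negP=> /connectP[p e_p last_p].
case: (shortenP e_p) last_p => {e_p}p e_p p_uniq _ last_p.
have [os [oE tE eos]] := path_edges e_p.
have [_ /(_ ((e, eps) :: os))/negP[]] := Gamma_tree.
have [os_path os_last] := path_edges_path (o0 := (e, eps)) (erefl _) oE tE.
rewrite /circuit /= rcons_path os_path os_last -last_p eqxx /=.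
rewrite eos (path_edges_uniq oE tE p_uniq) oE /origin /= andbT last_p.
by rewrite lastI rcons_uniq in p_uniq.
Qed.

(** The 2-colouring of the vertices by the two components left when e is removed,
    the end e(eps) being on the side [true]. *)
Definition edge_cut (e : E) (eps : bool) (side : V -> bool) : Prop :=
  [/\ side (ends e eps) = true, side (ends e (~~ eps)) = false &
      forall e', e' != e -> side (ends e' true) = side (ends e' false)].

Lemma edge_cut_ex (e : E) (eps : bool) : exists side, edge_cut e eps side.
Proof.
exists (fun u => connect (adjacent_without e) u (ends e eps)).
split; first exact: connect0.
  exact/negbTE/tree_edge_separates.
move=> e' ne; have step b : adjacent_without e (ends e' b) (ends e' (~~ b)).
  by apply/existsP; exists e'; apply/existsP; exists b; rewrite ne !eqxx.
apply/idP/idP; apply: connect_trans; apply: connect1; exact: step.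
Qed.

(** Connectedness of the subgraph spanned by S, expressed by colourings constant
    along its edges: this is the form in which edge cuts use it. *)
Definition spans_connected (S : {set V}) : Prop :=
  forall f : V -> bool,
    (forall e, (forall eps, ends e eps \in S) -> f (ends e true) = f (ends e false)) ->
  {in S &, forall u w, f u = f w}.

Lemma edge_cut_away e eps side S : spans_connected S ->
  edge_cut e eps side -> ends e eps \notin S -> ends e (~~ eps) \in S ->
  {in S, forall u, side u = false}.
Proof.
move=> cS [s1 s2 s3] e_out e_in u Su; rewrite -s2; apply: cS => // e' e'S.
by apply: s3; apply: contraNneq e_out => <-.
Qed.

(** S is connected without the edge e that attaches the new vertex, so it lies on
    one side of the cut of e; this excludes any other edge between S and the
    new vertex. *)
Lemma tree_growth (Pr : {set V} -> Prop) (v0 : V) :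
  Pr [set v0]%SET ->
  (forall S e eps, Pr S -> v0 \in S -> ends e eps \notin S ->
     ends e (~~ eps) \in S ->
     (forall side, edge_cut e eps side -> {in S, forall u, side u = false}) ->
     Pr (ends e eps |: S)%SET) ->
  Pr [set: V]%SET.
Proof.
move=> Pr0 PrS.
have main n S : #|(~: S)%SET| = n -> v0 \in S -> spans_connected S -> Pr S -> Pr [set: V]%SET.
  elim: n S => [|n IHn] S.
    by move=> /cards0_eq S0 _ _; rewrite -[S]finset.setCK S0 finset.setC0.
  move=> cardS v0S cS PS.
  have [e [eps [e_out e_in]]] : exists e eps,
      ends e eps \notin S /\ ends e (~~ eps) \in S.
    apply: contrapT => none.
    have clS : closed (@adjacent Gamma) S.
      move=> u v /existsP[e /existsP[eps /andP[/eqP <- /eqP <-]]].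
      apply/idP/idP => [uS|vS]; apply: contrapT => /negP out; apply: none.
        by exists e, (~~ eps); rewrite negbK.
      by exists e, eps.
    have /card_gt0P[w] : (0 < #|(~: S)%SET|)%N by rewrite cardS.
    have [[_ conn] _] := Gamma_tree.
    by rewrite inE -(closed_connect clS (conn v0 w)) v0S.
  have cut_S side : edge_cut e eps side -> {in S, forall u, side u = false}.
    by move=> cut; apply: edge_cut_away cut _ _.
  apply: (IHn (ends e eps |: S)%SET).
  - have := cardS; rewrite (cardsD1 (ends e eps)) inE e_out add1n => -[<-].
    by apply: eq_card => u; rewrite !inE negb_or.
  - by rewrite inE v0S orbT.
  - move=> f fS.
    have fS' : {in S &, forall u w, f u = f w}.
      by apply: cS => e' e'S; apply: fS => b; rewrite inE e'S orbT.
    have fe : {in S, forall w, f (ends e eps) = f w}.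
      move=> w Sw; rewrite -(fS' _ _ e_in Sw).
      have -> : f (ends e eps) = f (ends e (~~ eps)) => //.
      have : f (ends e true) = f (ends e false).
        apply: fS => b; rewrite !inE; have [->|/negbTE nb] := eqVneq b eps.
          by rewrite eqxx.
        by have -> : b = ~~ eps; [case: b eps nb {e_out e_in cut_S} => -[] | rewrite e_in orbT].
      by case: (eps).
    by move=> u w; rewrite !inE => /orP[/eqP->|Su] /orP[/eqP->|Sw] //;
      [exact: fe | apply/esym/fe | exact: fS'].
  - exact: PrS.
apply: (main _ [set v0]%SET erefl) => //; first by rewrite inE.
by move=> f _ u w; rewrite !inE => /eqP-> /eqP->.
Qed.
End TreeGrowth.

(** * Tree products and the separation criterion *)

Lemma conj_hom_morph (R : groupType) (d : R) : {morph (fun x => x ^ d) : x y / x * y}.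
Proof. by move=> x y; apply: conjMg. Qed.
Definition conj_hom (R : groupType) (d : R) : hom R R := hom_of (conj_hom_morph d).

Section TreeProductTheory.
Variables (Gamma : finite_graph) (GG : graph_of_groups Gamma).
Local Notation V := (vertex Gamma).
Local Notation P := (tree_product GG).
Local Notation G := (vgroup GG).

Definition class_of_word (w : word GG) : P :=
  (\pi_(word_class GG) w)%qT.

Lemma class_of_word_cat w w' :
  class_of_word (w ++ w') = class_of_word w * class_of_word w'.
Proof. exact/esym/word_class_mulE. Qed.

Lemma vertex_hom_morph v : {morph (fun x : G v => class_of_word (letter x)) : x y / x * y}.
Proof.
by move=> x y; rewrite -class_of_word_cat; apply/esym/word_class_eq/word_cong_mul.
Qed.
Definition vertex_hom v : hom (G v) P := hom_of (vertex_hom_morph (v := v)).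

Definition letter_class (l : {v : V & G v}) : P := vertex_hom (tag l) (tagged l).

Lemma class_of_wordE w : class_of_word w = \prod_(l <- w) letter_class l.
Proof.
elim: w => [|[v x] w IHw]; first by rewrite big_nil.
by rewrite -cat1s class_of_word_cat big_cat big_seq1 -IHw.
Qed.

Lemma tree_product_gen (x : P) : exists w : word GG, x = \prod_(l <- w) letter_class l.
Proof. by elim/quotW: x => w; exists w; rewrite -class_of_wordE. Qed.

Lemma vertex_hom_edge e eps (h : egroup GG e) :
  vertex_hom _ (emap GG e eps h) = vertex_hom _ (emap GG e true h).
Proof.
by case: eps => //; apply/word_class_eq/word_cong_sym/word_cong_edge.
Qed.

(** Both sides of each defining relation have the same product in R. *)
Lemma tree_product_univ (R : groupType) (th : forall v, hom (G v) R) :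
  (forall e h, th _ (emap GG e true h) = th _ (emap GG e false h)) ->
  exists s : hom P R, forall v (x : G v), s (vertex_hom v x) = th v x.
Proof.
move=> thE; pose ev (w : word GG) : R := \prod_(l <- w) th (tag l) (tagged l).
have ev_cong w w' : word_cong w w' -> ev w = ev w'.
  elim=> {w w'} //.
  - by move=> w w' w'' _ -> _ ->.
  - by move=> u u' w w' _ eu _ ew; rewrite /ev !big_cat /= -!/(ev _) eu ew.
  - by move=> v; rewrite /ev big_seq1 big_nil; apply: hom1.
  - by move=> v x y; rewrite /ev big_cat !big_seq1; apply/esym/homM.
  - by move=> e h; rewrite /ev !big_seq1; apply: thE.
have sE w : ev (repr (class_of_word w)) = ev w.
  by apply: ev_cong; apply: word_class_reprE.
have sM : {morph (fun x : P => ev (repr x)) : x y / x * y}.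
  elim/quotW => w; elim/quotW => w'.
  rewrite -!/(class_of_word _) -class_of_word_cat !sE.
  exact: big_cat.
exists (hom_of sM) => v x; rewrite hom_ofE [vertex_hom v x]hom_ofE sE.
by rewrite /ev big_seq1.
Qed.

Lemma tree_product_hom_ext (R : groupType) (s r : hom P R) :
  (forall v x, s (vertex_hom v x) = r (vertex_hom v x)) -> forall x, s x = r x.
Proof.
move=> sr x; have [w ->] := tree_product_gen x; rewrite !gmulf_prod.
by apply: eq_bigr => -[v y] _; apply: sr.
Qed.

Definition spanned_set (S : pred V) : set P :=
  [set x | exists2 w : word GG, all (fun l => S (tag l)) w &
           x = \prod_(l <- w) letter_class l].

Lemma spanned_is_subgroup S : is_subgroup (spanned_set S).
Proof.
split; first by exists [::]; rewrite ?big_nil.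
- move=> _ _ [w Sw ->] [w' Sw' ->]; exists (w ++ w'); first by rewrite all_cat Sw.
  by rewrite big_cat.
- move=> _ [w Sw ->]; exists (word_inv w).
    rewrite /word_inv all_rev all_map; apply: sub_all Sw; by case.
  elim: w {Sw} => [|[v x] w IHw]; first by rewrite !big_nil invg1.
  rewrite /word_inv map_cons rev_cons -cats1 big_cat big_seq1 -/(word_inv w) -IHw.
  by rewrite big_cons invgM; congr (_ * _); apply/esym/homV.
Qed.

Definition spanned S : subgroup P := subgroup_of (spanned_is_subgroup S).

Lemma spanned_vertex (S : pred V) v (x : G v) : S v -> carrier (spanned S) (vertex_hom v x).
Proof.
by move=> Sv; exists (letter x); rewrite ?big_seq1 //= Sv.
Qed.

Lemma spanned_sub (S T : pred V) : subpred S T -> carrier (spanned S) `<=` carrier (spanned T).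
Proof. by move=> ST _ [w Sw ->]; exists w => //; apply: sub_all Sw => l; apply: ST. Qed.

Lemma spanned_full (x : P) : carrier (spanned predT) x.
Proof. by have [w ->] := tree_product_gen x; exists w => //; apply/allP. Qed.

Lemma hom_eq_on_spanned (S : pred V) (R : groupType) (s r : hom P R) :
  (forall v x, S v -> s (vertex_hom v x) = r (vertex_hom v x)) ->
  forall x, carrier (spanned S) x -> s x = r x.
Proof.
move=> sr _ [w Sw ->]; rewrite !gmulf_prod; elim: w Sw => [|[v x] w IHw] /=.
  by rewrite !big_nil.
by move=> /andP[Sv Sw]; rewrite !big_cons IHw //; congr (_ * _); apply: sr.
Qed.

Lemma spanned1 (S : pred V) v : (forall u, S u -> u = v) ->
  forall x, carrier (spanned S) x -> exists y, vertex_hom v y = x.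
Proof.
move=> Sv _ [w Sw ->]; elim: w Sw => [_|[u x] w IHw].
  by exists 1; rewrite big_nil hom1.
move=> /andP[Su /IHw[y yE]]; have uv : u = v := Sv u Su; subst u; exists (x * y).
by rewrite homM big_cons yE.
Qed.

Definition edge_image e : subgroup P :=
  range_subgroup (hom_comp (vertex_hom _) (emap GG e true)).

Lemma edge_imageP e eps x :
  carrier (edge_image e) x <-> exists h, x = vertex_hom _ (emap GG e eps h).
Proof.
split=> [/range_subgroupP[h <-]|[h ->]]; first by exists h; rewrite vertex_hom_edge.
by apply/range_subgroupP; exists h; rewrite vertex_hom_edge.
Qed.

Lemma edge_image_spanned e eps (S : pred V) :
  S (ends e eps) -> carrier (edge_image e) `<=` carrier (spanned S).
Proof. by move=> Se x /(@edge_imageP e eps)[h ->]; apply: spanned_vertex. Qed.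

(** Conjugate by d on the vertex groups of one side of the cut. The edge e is the
    only one with ends on different sides, and its group is centralised by d. *)
Lemma edge_twistable e eps side : edge_cut e eps side ->
  twistable (fun t => carrier (spanned (fun u => side u == t))) (edge_image e).
Proof.
move=> [s1 s2 s3] t R s d dH.
pose th v : hom (G v) R :=
  if side v == t then hom_comp s (vertex_hom v)
  else hom_comp (conj_hom d) (hom_comp s (vertex_hom v)).
have [|r rE] := tree_product_univ (th := th).
  move=> e' h; have sE := congr1 s (vertex_hom_edge (e := e') false h).
  have [ee'|ne] := eqVneq e' e; last first.
    by rewrite /th s3 //; case: ifP => _; rewrite !hom_compE sE.
  subst e'; suff H b : th (ends e b) (emap GG e b h) = s (vertex_hom _ (emap GG e true h)).
    by rewrite !H.
  rewrite /th; case: ifP => _; rewrite !hom_compE vertex_hom_edge //.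
  rewrite hom_ofE; apply/conjg_fixP/commgP/commute_sym/dH.
  by apply/(@edge_imageP e true); exists h.
exists r; split.
- apply: hom_eq_on_spanned => v x vt; rewrite rE /th vt //.
- move=> b bt; apply: (hom_eq_on_spanned (r := hom_comp (conj_hom d) s) _ bt).
  by move=> v x /eqP vt; rewrite rE /th vt; case: (t).
- move=> R' g gd x; apply: (tree_product_hom_ext (s := hom_comp g r) (r := hom_comp g s)).
  move=> v y; rewrite !hom_compE rE /th; case: ifP => _; rewrite !hom_compE ?hom_ofE //.
  by rewrite gmulfJ gd conjg1.
Qed.

Hypothesis Gamma_tree : is_tree Gamma.

(** The subgroups from which elements must be separated; the trivial one yields
    residual C-ness, the edge subgroups drive the induction. *)
Definition test_subgroup (v : V) (L : set P) : Prop :=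
  L = [set 1] \/ exists e eps, ends e eps = v /\ L = carrier (edge_image e).

Lemma test_subgroup_spanned (S : pred V) v L :
  S v -> test_subgroup v L -> L `<=` carrier (spanned S).
Proof.
move=> Sv [->|[e [eps [ev ->]]]]; last by apply: (@edge_image_spanned e eps); rewrite ev.
by move=> x ->; apply: subgroup1.
Qed.

(** Induction over a growing set S of vertices, for the elements of the subgroup
    generated by the vertex groups of S. Attaching a vertex along e amounts to
    an amalgam over H_e. The letters of an alternating word can be separated
    from H_e by induction or by hypothesis, and then so can the word from either
    factor, hence from all the subgroups to be considered; single letters and
    elements of H_e lie in a factor and are known already. *)
Lemma tree_product_separated (C : group_class) (rC : root_class C) :
  (forall v (x : G v) L, test_subgroup v L -> ~ L (vertex_hom v x) ->
     separated C L (vertex_hom v x)) ->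
  forall x v L, test_subgroup v L -> ~ L x -> separated C L x.
Proof.
move=> sepV x0 v0.
pose Pr (S : {set V}) := forall x, carrier (spanned (mem S)) x ->
  forall v L, v \in S -> test_subgroup v L -> ~ L x -> separated C L x.
suff PrT : Pr [set: V]%SET.
  move=> L; apply: PrT; last by rewrite inE.
  by apply: spanned_sub (spanned_full x0) => u _; rewrite /= inE.
apply: (tree_growth Gamma_tree (v0 := v0)) => [|S e eps IH v0S e_out e_in cut_S].
  move=> x xS v L; rewrite inE => /eqP -> testL Lx.
  have [|y yx] := spanned1 (v := v0) _ xS; first by move=> u; rewrite /= inE => /eqP.
  by rewrite -yx; apply: sepV => //; rewrite yx.
have [side cut] := edge_cut_ex Gamma_tree e eps; have Sside := cut_S side cut.
pose v1 := ends e eps; pose H := edge_image e.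
pose on (t : bool) (v : V) := if t then v == v1 else v \in S.
pose sd t := spanned (on t).
have on_side t u : on t u -> side u = t.
  by case: t => [/eqP -> |/Sside //]; have [] := cut.
have tw : twistable (fun t => carrier (sd t)) H.
  apply: twistable_sub (edge_twistable cut) => t.
  by apply: spanned_sub => u /on_side ->.
have H_sd t : carrier H `<=` carrier (sd t).
  case: t; [apply: (@edge_image_spanned e eps) | apply: (@edge_image_spanned e (~~ eps))].
    exact: eqxx.
  exact: e_in.
have sep_sd t y : carrier (sd t) y -> forall v L, on t v -> test_subgroup v L ->
    ~ L y -> separated C L y.
  case: t => [ty v L /eqP -> testL Ly|ty v L]; last exact: IH.
  have [|z zy] := spanned1 (v := v1) _ ty; first by move=> u /eqP.
  by rewrite -zy; apply: sepV => //; rewrite zy.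
have testH t : exists2 v, on t v & test_subgroup v (carrier H).
  case: t; [exists v1; first exact: eqxx | exists (ends e (~~ eps)); first exact: e_in].
    by right; exists e, eps.
  by right; exists e, (~~ eps).
have sepH t y : carrier (sd t) y -> ~ carrier H y -> separated C (carrier H) y.
  by move=> ty; have [v tv testv] := testH t; apply: sep_sd ty v _ tv testv.
move=> x [w Sw xE] v L vS testL Lx.
have [t tv] : exists t, on t v.
  by move: vS; rewrite !inE => /orP[?|?]; [exists true | exists false].
have L_sd : L `<=` carrier (sd t) by apply: test_subgroup_spanned tv testL.
have nf : normal_form sd H x.
  rewrite xE -(big_map (@letter_class) xpredT id); apply: normal_form_prod => //.
  move=> _ /mapP[[u y] u_w ->]; have := allP Sw _ u_w; rewrite /= !inE => /orP[uv|uS].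
    by exists true; apply: spanned_vertex.
  by exists false; apply: spanned_vertex.
case: nf => [Hx|[t0 [xs [alt_xs xs0 xsE]]]].
  by apply: (sep_sd t) tv testL Lx; apply: H_sd.
have sep_xs : {in xs, forall y, separated C (carrier H) y}.
  elim: xs t0 alt_xs {xs0 xsE} => [|y xs IHxs] t0 //= [ty Hy alt_xs] z.
  by rewrite inE => /orP[/eqP ->|]; [apply: sepH Hy; exact: ty | apply: IHxs alt_xs _].
case: xs xs0 alt_xs xsE sep_xs => [//|y [|z xs]] _ alt_xs xsE sep_xs.
  have [tE|tE] : t0 = t \/ t0 = ~~ t by case: (t0) (t) => -[]; auto.
    by apply: (sep_sd t) tv testL Lx; case: alt_xs; rewrite xsE big_seq1 tE.
  apply: separated_sub L_sd _; rewrite xsE.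
  by apply: (alternating_separated tw H_sd rC alt_xs) => //; right.
apply: separated_sub L_sd _; rewrite xsE.
by apply: (alternating_separated tw H_sd rC alt_xs) => //; left.
Qed.
End TreeProductTheory.

(** * Central products over a tree *)

Section CentralProduct.
Variables (Gamma : finite_graph) (GG : graph_of_groups Gamma).
Local Notation V := (vertex Gamma).
Local Notation P := (tree_product GG).
Local Notation G := (vgroup GG).

Definition edge_faithful v (Q : groupType) (f : hom (G v) Q) : Prop :=
  forall e eps (ev : ends e eps = v),
    set_inj (edge_subgroup_at GG ev) f /\
    forall x, edge_subgroup_at GG ev x -> center Q (f x).

Lemma edge_faithful_inj e eps (Q : groupType) (f : hom (G (ends e eps)) Q) :
  edge_faithful f -> injective (hom_comp f (emap GG e eps)).
Proof.
move=> /(_ e eps erefl)[f_inj _] h k fhk; apply: (@emap_inj _ GG e eps).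
by apply: f_inj => //; apply/mem_set; [exists h | exists k].
Qed.

Lemma edge_faithful_center e eps (Q : groupType) (f : hom (G (ends e eps)) Q) h :
  edge_faithful f -> center Q (f (emap GG e eps h)).
Proof. by move=> /(_ e eps erefl)[_ fc]; apply: fc; exists h. Qed.

Lemma edge_faithful_comp v (Q R : groupType) (f : hom (G v) Q) (g : hom Q R) :
  injective g -> (forall z, center Q z -> center R (g z)) ->
  edge_faithful f -> edge_faithful (hom_comp g f).
Proof.
move=> g_inj gc ff e eps ev; have [f_inj fc] := ff e eps ev.
split=> [x y ex ey /g_inj|x /fc/gc //]; exact: f_inj.
Qed.

(** The quotient of A * B by the elements (a k, (b k)^-1), which are central. *)
Lemma central_amalgam (A B K : groupType) (a : hom K A) (b : hom K B) :
  injective a -> injective b -> (forall k, center A (a k)) ->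
  (forall k, center B (b k)) ->
  exists (N : groupType) (p : hom (A * B)%type N),
    [/\ onto p, injective (hom_comp p (hom_inl A B)),
        injective (hom_comp p (hom_inr A B)) &
        forall k, p (a k, 1) = p (1, b k)].
Proof.
move=> a_inj b_inj ac bc.
have dM : {morph (fun k => (a k, (b k)^-1) : (A * B)%type) : k l / k * l}.
  move=> k l; congr pair; first exact: homM.
  by rewrite homM (bc k) invgM.
have dc : range_subgroup (hom_of dM) `<=` center (A * B)%type.
  move=> _ [k _ <-] [x y]; congr pair; first exact: ac.
  by apply/commute_sym/commuteV/commute_sym/bc.
exists (quotient_group (central_normal dc)), (quot (central_normal dc)).
split; first exact: quot_onto.
- apply: hom_inj => x /quot_eq1 [k _ [<- /eqP]]; rewrite invg_eq1 => /eqP bk.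
  by have -> : k = 1 by [apply: b_inj; rewrite bk hom1]; rewrite hom1.
- apply: hom_inj => y /quot_eq1 [k _ [ak <-]].
  by have -> : k = 1 by [apply: a_inj; rewrite ak hom1]; rewrite hom1 invg1.
- move=> k; apply/quot_eq; exists k^-1 => //; congr pair.
    by rewrite homV mulg1.
  by rewrite !homV invgK invg1 mul1g.
Qed.

Variables (D : group_class).
Hypothesis D_prod : forall X Y : groupType, D X -> D Y -> D (X * Y)%type.
Hypothesis D_onto : forall (X Y : groupType) (f : hom X Y), onto f -> D X -> D Y.
Hypothesis Gamma_tree : is_tree Gamma.
Hypothesis D_faithful : forall v, exists2 Q : groupType, D Q &
  exists f : hom (G v) Q, edge_faithful f.

(** Grow the tree from v0, gluing at each step a group with faithful edge
    subgroups to what has been built, along the central subgroup of the new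
    edge. The group R at the root need not be the one supplied for v0, and
    remains embedded throughout. *)
Lemma tree_central_product v0 (R : groupType) (rho : hom (G v0) R) :
  D R -> edge_faithful rho ->
  exists2 N : groupType, D N & exists (s : hom P N) (i : hom R N),
    [/\ injective i, forall x, s (vertex_hom GG v0 x) = i (rho x) &
        edge_faithful (hom_comp s (vertex_hom GG v0))].
Proof.
move=> DR rho_f.
pose Pr (S : {set V}) := exists2 N : groupType, D N &
  exists (th : forall v, hom (G v) N) (i : hom R N),
  [/\ injective i, forall x, th v0 x = i (rho x),
      forall e, (forall eps, ends e eps \in S) ->
        forall h, th _ (emap GG e true h) = th _ (emap GG e false h) &
      forall v, v \in S -> edge_faithful (th v)].
suff [N DN [th [i [i_inj th0 thE thf]]]] : Pr [set: V]%SET.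
  have [|s sE] := tree_product_univ (th := th).
    by move=> e; apply: thE => eps; rewrite inE.
  exists N => //; exists s, i; split=> // [x|]; first by rewrite sE th0.
  move=> e eps ev; have [|th_inj thc] := thf v0 _ e eps ev; first by rewrite inE.
  by split=> [x y ex ey|x ex]; rewrite ?hom_compE !sE; [apply: th_inj | apply: thc].
apply: (tree_growth Gamma_tree (v0 := v0)).
  (* Only the homomorphism at v0 is constrained so far; the others are defaults. *)
  exists R => //; exists (dfwith (fun v => hom_one (G v) R) rho), (hom_id R).
  split=> //; first by move=> x; rewrite dfwith_in.
    move=> e e0; case/negP: (tree_no_loop Gamma_tree e true).
    by have := e0 true; have := e0 false; rewrite !inE => /eqP /= -> /eqP ->.
  by move=> v; rewrite inE => /eqP ->; rewrite dfwith_in.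
move=> S e eps [N DN [th [i [i_inj th0 thE thf]]]] v0S e_out e_in cut_S.
have [Q DQ [f ff]] := D_faithful (ends e eps).
have thu := thf _ e_in.
have [M [p [p_onto p1_inj p2_inj pE]]] := central_amalgam (edge_faithful_inj thu)
  (edge_faithful_inj ff) (fun h => edge_faithful_center h thu)
  (fun h => edge_faithful_center h ff).
pose p1 := hom_comp p (hom_inl N Q); pose p2 := hom_comp p (hom_inr N Q).
have onto_center z : center (N * Q)%type z -> center M (p z).
  by move=> zc y; have [t <-] := p_onto y; apply: gmulf_commute.
have p1c z : center N z -> center M (p1 z).
  move=> zc; apply: onto_center => -[x y]; congr pair; first exact: zc.
  by rewrite /= mul1g mulg1.
have p2c z : center Q z -> center M (p2 z).
  move=> zc; apply: onto_center => -[x y]; congr pair; last exact: zc.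
  by rewrite /= mul1g mulg1.
pose th' := dfwith (fun v => hom_comp p1 (th v)) (hom_comp p2 f).
have th'_in : th' (ends e eps) = hom_comp p2 f by rewrite /th' dfwith_in.
have th'_out v : v \in S -> th' v = hom_comp p1 (th v).
  by move=> vS; rewrite /th' dfwith_out //; apply: contraNneq e_out => ->.
exists M; first by apply: D_onto p_onto _; apply: D_prod.
exists th', (hom_comp p1 i); split.
- by move=> x y /p1_inj/i_inj.
- by move=> x; rewrite th'_out // !hom_compE th0.
- move=> e' e'S h; have [ee'|ne] := eqVneq e' e.
    subst e'; suff H b : th' _ (emap GG e b h) = p2 (f (emap GG e eps h)) by rewrite !H.
    have [->|->] : b = eps \/ b = ~~ eps by case: (b) (eps) => -[]; auto.
      by rewrite th'_in.
    by rewrite th'_out //; apply: pE.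
  have [side cut] := edge_cut_ex Gamma_tree e eps; have Sside := cut_S side cut.
  have [s1 s2 s3] := cut.
  have e'_in b : ends e' b \in S.
    have := e'S b; rewrite !inE => /orP[/eqP be|//].
    have := e'S (~~ b); rewrite !inE => /orP[/eqP nbe|/Sside nb].
      by have := tree_no_loop Gamma_tree e' b; rewrite be nbe eqxx.
    have : side (ends e' b) = side (ends e' (~~ b)) by case: (b); rewrite /= s3.
    by rewrite nb be s1.
  by rewrite !th'_out // !hom_compE thE.
- move=> v; rewrite !inE => /orP[/eqP ->|vS].
    by rewrite th'_in; apply: edge_faithful_comp.
  by rewrite th'_out //; apply: edge_faithful_comp => //; apply: thf.
Qed.
End CentralProduct.

(** * Isolated edge subgroups imply residual C-ness *)

Section Sufficiency.
Variables (C : group_class) (rC : root_class C).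
Hypothesis C_periodic : forall X : groupType, C X -> periodic X.

Lemma isolated_coprime (X : groupType) (Y : set X) x q :
  isolated (primes_of' C) Y -> coprime_to_class C q -> Y (x ^+ q) -> Y x.
Proof.
move=> isoY; elim/ltn_ind: q x => q IHq x [q0 Cq].
have [|q1] := leqP q 1; first by case: q q0 {IHq Cq} => [|[|q]] //; rewrite expg1.
have p_pr := pdiv_prime q1; have /dvdnP[k kE] := pdiv_dvd q.
have k0 : (0 < k)%N by move: q0; rewrite {1}kE muln_gt0 => /andP[].
rewrite [in x ^+ q]kE expgnA => Yk; apply: (IHq k).
- by rewrite [X in (_ < X)%N]kE -[X in (X < _)%N]muln1 ltn_pmul2l // prime_gt1.
- by split=> // r r_pr rk; apply: Cq => //; rewrite kE; apply: dvdn_mulr.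
- by apply: isoY Yk; split=> //; apply: Cq => //; apply: pdiv_dvd.
Qed.

Lemma residually_torsion_free (X : groupType) :
  residually (BN C) X -> torsion_free (primes_of' C) X.
Proof.
move=> resX x q Cq xq; apply: contrapT => /resX[Y [tfY _] [f [_ fx]]].
by apply/fx/(tfY _ q Cq); rewrite /= -homX xq hom1.
Qed.

(** If f already keeps all P(C)'-powers of x outside f(H), nothing is to be done.
    Otherwise f(x^q0) = f(h0), and x^q0 / h0 is non-trivial since H is isolated;
    let g be non-trivial on it. A further coincidence of x^q with h under f and
    g would force h^q0 = h0^q, since f is injective on H, and then kill the q-th
    power of g(x^q0 / h0) in a P(C)'-torsion-free group. *)
Lemma avoid_isolator (X : groupType) (H : subgroup X) (Q : groupType)
    (f : hom X Q) (x : X) :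
  carrier H `<=` center X -> residually (BN C) X -> BN C Q ->
  range f = [set: Q] -> set_inj (carrier H) f ->
  isolated (primes_of' C) (carrier H) -> ~ carrier H x ->
  exists2 Y : groupType, BN C Y & exists g : hom X Y, range g = [set: Y] /\
    forall q h, coprime_to_class C q -> carrier H h ->
      hom_pair f g (x ^+ q) <> hom_pair f g h.
Proof.
move=> Hc resX BNQ f_onto f_inj isoH Hx.
have [[q0 [h0 [Cq0 Hh0 fq0]]]|none] := pselect (exists q h,
    [/\ coprime_to_class C q, carrier H h & f (x ^+ q) = f h]); last first.
  by exists Q => //; exists f; split=> // q h Cq Hh [e _]; apply: none; exists q, h.
have z1 : x ^+ q0 / h0 <> 1.
  by move/divg1_eq=> xh0; apply/Hx/(isolated_coprime isoH Cq0); rewrite xh0.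
have [Y [tfY bY] [g [g_onto gz]]] := resX _ z1.
exists Y => //; exists g; split=> // q h Cq Hh [fq gq]; apply: gz.
apply: (isolated_coprime tfY Cq) => /=.
(* Both sides have the image f(x)^(q q0). *)
have hh0 : h ^+ q0 = h0 ^+ q.
  apply: f_inj; [exact/mem_set/subgroupX|exact/mem_set/subgroupX|].
  by rewrite !homX -fq0 -fq !homX expgnAC.
rewrite -homX expgnFl; last exact/commute_sym/Hc.
by rewrite expgnAC homM homX gq -homX hh0 homV mulgV.
Qed.

Variables (Gamma : finite_graph) (GG : graph_of_groups Gamma).
Hypothesis Gamma_tree : is_tree Gamma.
Hypothesis edge_central : forall e eps,
  edge_subgroup GG e eps `<=` center (vgroup GG (ends e eps)).
Hypothesis vgroup_residually : forall v, residually (BN C) (vgroup GG v).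
Hypothesis vgroup_hom : forall v,
  exists2 Q : groupType, BN C Q &
    exists f : hom (vgroup GG v) Q,
      range f = [set: Q] /\
      forall e eps (ev : ends e eps = v), set_inj (edge_subgroup_at GG ev) f.

Lemma hom_center (X Y : groupType) (f : hom X Y) x :
  range f = [set: Y] -> center X x -> center Y (f x).
Proof.
move=> f_onto xc y; have [z _ <-] : range f y by rewrite f_onto.
exact: gmulf_commute.
Qed.

Lemma edge_subgroup_at_center v e eps (ev : ends e eps = v) :
  edge_subgroup_at GG ev `<=` center (vgroup GG v).
Proof. by case: v / ev; apply: edge_central. Qed.

Lemma onto_edge_faithful v (Q : groupType) (f : hom (vgroup GG v) Q) :
  range f = [set: Q] ->
  (forall e eps (ev : ends e eps = v), set_inj (edge_subgroup_at GG ev) f) ->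
  edge_faithful f.
Proof.
move=> f_onto f_inj e eps ev; split; first exact: f_inj.
by move=> x /edge_subgroup_at_center; apply: hom_center.
Qed.

(** Map all vertex groups to bounded nilpotent groups, the one at v by the pair
    of homomorphisms that avoids the isolator of H, form the central product
    over the tree and divide it by the image of H. *)
Lemma vertex_separated v (x : vgroup GG v) (H : subgroup (vgroup GG v)) :
  carrier H `<=` center (vgroup GG v) ->
  (forall (Q : groupType) (f : hom (vgroup GG v) Q), edge_faithful f ->
     set_inj (carrier H) f /\ forall h, carrier H h -> center Q (f h)) ->
  isolated (primes_of' C) (carrier H) -> ~ carrier H x ->
  separated C (vertex_hom GG v @` carrier H) (vertex_hom GG v x).
Proof.
move=> Hc H_faithful isoH Hx.
have tame_faithful u : exists2 Q : groupType, tame_nilpotent C Q &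
    exists f : hom (vgroup GG u) Q, edge_faithful f.
  have [Q [_ bQ] [f [f_onto f_inj]]] := vgroup_hom u.
  exists Q; first exact: bounded_nilpotent_tame_nilpotent.
  by exists f; apply: onto_edge_faithful.
have [Q BQ [f [f_onto f_inj]]] := vgroup_hom v.
have ff := onto_edge_faithful f_onto f_inj.
have [Y BY [g [g_onto fgx]]] := avoid_isolator Hc (@vgroup_residually v) BQ f_onto
  (H_faithful Q f ff).1 isoH Hx.
have fg_faithful : edge_faithful (hom_pair f g).
  move=> e eps ev; split=> [y z ey ez [fyz _]|y ey]; first exact: (f_inj e eps ev).
  have yc := edge_subgroup_at_center ey.
  by move=> [a b]; congr pair; [apply: (hom_center f_onto yc) | apply: (hom_center g_onto yc)].
have tQY : tame_nilpotent C (Q * Y)%type.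
  case: BQ BY => [_ bQ] [_ bY].
  by apply: (tame_nilpotent_prod rC); apply: (bounded_nilpotent_tame_nilpotent rC).
have [N tN [s [i [i_inj sE sf]]]] := tree_central_product (tame_nilpotent_prod rC)
  (@tame_nilpotent_onto C) Gamma_tree tame_faithful tQY fg_faithful.
pose sv := hom_comp s (vertex_hom GG v).
have Mc : image_subgroup sv H `<=` center N.
  by move=> _ [h Hh <-]; apply: (H_faithful N sv sf).2.
pose M := central_normal Mc.
have [|Z CZ [k kx]] := tame_nilpotent_separates rC C_periodic
    (x := quot M (sv x)) (tame_nilpotent_onto (@quot_onto _ M) tN).
  move=> q Cq; rewrite -!homX => /quot_eq1 [h Hh]; rewrite /sv !hom_compE !sE.
  by move/i_inj/esym; apply: fgx.
exists Z => //; exists (hom_comp k (hom_comp (quot M) s)) => -[_ [h Hh <-] hE].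
apply: kx; rewrite -[LHS]hE !hom_compE -[RHS](hom1 k); congr (k _).
by apply/quot_eq1; exists h.
Qed.

Theorem residually_of_isolated :
  (forall e eps, isolated (primes_of' C) (edge_subgroup GG e eps)) ->
  residually C (tree_product GG).
Proof.
move=> iso_edge x x1.
have sepV v (y : vgroup GG v) L : test_subgroup v L -> ~ L (vertex_hom GG v y) ->
    separated C L (vertex_hom GG v y).
  move=> [->|[e [eps [ev ->]]]] Ly.
    apply: (separated_sub _ (vertex_separated (H := trivial_subgroup _) _ _ _ _)).
    - by move=> _ ->; exists 1 => //; apply: hom1.
    - by move=> h h1 z; rewrite (h1 : h = 1); apply/commute_sym/commute1.
    - move=> Q f _; split=> [a b /set_mem a1 /set_mem b1 _|h h1 z].
        by rewrite (a1 : a = 1) (b1 : b = 1).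
      by rewrite (h1 : h = 1) hom1; apply/commute_sym/commute1.
    - by move=> z q Cq /=; apply: residually_torsion_free (@vgroup_residually v) _ _ Cq.
    - by move=> y1; apply: Ly; rewrite (y1 : y = 1); apply: hom1.
  case: v / ev y Ly => y Ly.
  apply: (separated_sub _ (vertex_separated (H := range_subgroup (emap GG e eps)) _ _ _ _)).
  - move=> _ /(@edge_imageP _ GG e eps) [h ->].
    by exists (emap GG e eps h) => //; exists h.
  - by move=> z [h _ <-]; apply: edge_central; exists h.
  - move=> Q f ff; have [f_inj fc] := ff e eps erefl.
    by split=> // h; apply: fc.
  - exact: iso_edge.
  - by move=> [h _ hy]; apply: Ly; apply/(@edge_imageP _ GG e eps); exists h; rewrite hy.
have [v _] : exists v : vertex Gamma, true.
  by case: Gamma_tree => -[/card_gt0P[v _] _] _; exists v.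
have [|Q CQ [f fx]] := tree_product_separated Gamma_tree rC sepV
  (x := x) (v := v) (L := [set 1]) (or_introl erefl); first by [].
have Rf y : carrier (range_subgroup f) (f y) by apply/range_subgroupP; exists y.
exists (subgroup_group (range_subgroup f)); first exact: root_subgroup.
exists (corestrict Rf); split.
  apply/seteqP; split=> // y _; have /range_subgroupP[z zy] := subgroup_valP y.
  by exists z => //; apply: subgroup_val_inj; rewrite corestrictE zy.
move=> fx1; apply: fx; exists 1 => //.
by have := corestrictE Rf x; rewrite fx1 !hom1.
Qed.
End Sufficiency.

(** * Residual C-ness implies isolated edge subgroups *)

(** Separation in arbitrary groups: with this class, the results on alternating
    words express the non-triviality of such words. *)
Definition all_groups : group_class := fun _ => True.

Section Necessity.
Variables (C : group_class) (rC : root_class C).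
Hypothesis C_periodic : forall X : groupType, C X -> periodic X.

Lemma root_class_all_groups : root_class all_groups.
Proof.
by split=> //; have [X _ X1] := root_nontrivial rC; exists X.
Qed.

Variables (Gamma : finite_graph) (GG : graph_of_groups Gamma).
Hypothesis Gamma_tree : is_tree Gamma.
Hypothesis edge_central : forall e eps,
  edge_subgroup GG e eps `<=` center (vgroup GG (ends e eps)).

(** The tree product of the vertex groups maps to their central product, in which
    each of them embeds. *)
Lemma vertex_hom_separated e eps (x : vgroup GG (ends e eps)) :
  ~ edge_subgroup GG e eps x ->
  separated all_groups (carrier (edge_image GG e)) (vertex_hom GG _ x).
Proof.
move=> ex.
have id_faithful v : edge_faithful (hom_id (vgroup GG v)).
  by move=> e' b ev; split=> // y; apply: (edge_subgroup_at_center edge_central).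
have [|||N _ [s [i [i_inj sE _]]]] := @tree_central_product _ GG all_groups _ _
    Gamma_tree _ _ _ (hom_id _) I (id_faithful (ends e eps)) => //.
  by move=> v; exists (vgroup GG v) => //; exists (hom_id _).
exists N => //; exists s => -[_ /(@edge_imageP _ GG e eps)[h ->]].
by rewrite !sE => /i_inj hx; apply: ex; exists h.
Qed.

(** x y x^-1 y^-1 is an alternating word of length four with respect to the cut
    of e. *)
Lemma edge_amalgam_noncommuting e eps (x : vgroup GG (ends e eps))
    (y : vgroup GG (ends e (~~ eps))) :
  ~ edge_subgroup GG e eps x -> ~ edge_subgroup GG e (~~ eps) y ->
  ~ commute (vertex_hom GG _ x) (vertex_hom GG _ y).
Proof.
move=> ex ey xy; pose X := vertex_hom GG _ x; pose Y := vertex_hom GG _ y.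
have sepX : separated all_groups (carrier (edge_image GG e)) X := vertex_hom_separated ex.
have sepY : separated all_groups (carrier (edge_image GG e)) Y := vertex_hom_separated ey.
have sep_out z : separated all_groups (carrier (edge_image GG e)) z ->
    ~ carrier (edge_image GG e) z.
  by move=> [Q _ [f fz]] Hz; apply: fz; exists z.
have sepV z : separated all_groups (carrier (edge_image GG e)) z ->
    separated all_groups (carrier (edge_image GG e)) z^-1.
  move=> [Q _ [f fz]]; exists Q => //; exists f => -[h Hh hE]; apply: fz.
  by exists h^-1; [apply: subgroupV | rewrite homV hE homV invgK].
have [side cut] := edge_cut_ex Gamma_tree e eps; have [s1 s2 _] := cut.
pose sd t := spanned GG (fun u => side u == t).
have tw : twistable (fun t => carrier (sd t)) (edge_image GG e) := edge_twistable cut.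
have H_sd t : carrier (edge_image GG e) `<=` carrier (sd t).
  case: t; [apply: (@edge_image_spanned _ GG e eps) | apply: (@edge_image_spanned _ GG e (~~ eps))].
    by rewrite s1.
  by rewrite s2.
have sX : carrier (sd true) X by apply: spanned_vertex; rewrite s1.
have sY : carrier (sd false) Y by apply: spanned_vertex; rewrite s2.
pose w := [:: X; Y; X^-1; Y^-1].
have alt_w : alternating (fun t => carrier (sd t)) (edge_image GG e) true w.
  by split=> //; [exact: sep_out|split=> //; [exact: sep_out|split=> //;
    [exact: subgroupV|exact/sep_out/sepV|split=> //;
    [exact: subgroupV|exact/sep_out/sepV]]]].
have sep_w : {in w, forall z, separated all_groups (carrier (edge_image GG e)) z}.
  move=> z; rewrite !inE => /or4P[] /eqP -> //; exact: sepV.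
have [|Q _ [f]] := alternating_separated tw H_sd root_class_all_groups alt_w
  (t := true) sep_w; first by left.
apply; exists 1; first exact: subgroup1.
rewrite /w !big_cons big_nil mulg1 mulgA -invgM; congr (f _).
by rewrite (xy : X * Y = Y * X) mulgV.
Qed.

Hypothesis edge_proper : forall e eps, edge_subgroup GG e eps <> [set: _].

(** In a C-group the image of x is a power of the image of x^q, which is central
    at both ends of e; so x would commute with an element y outside the edge
    subgroup at the other end. *)
Theorem isolated_of_residually : residually C (tree_product GG) ->
  forall e eps, isolated (primes_of' C) (edge_subgroup GG e eps).
Proof.
move=> resP e eps x q [q_pr Cq] xq; apply: contrapT => ex.
have [y ey] : exists y, ~ edge_subgroup GG e (~~ eps) y.
  apply: contrapT => all_y; apply: (@edge_proper e (~~ eps)).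
  by apply/seteqP; split=> // y _; apply: contrapT => ey; apply: all_y; exists y.
have xy := edge_amalgam_noncommuting ex ey.
have xy1 : [~ vertex_hom GG _ x, vertex_hom GG _ y] <> 1.
  by move/eqP/commgP.
have [Q CQ [f [_ fxy]]] := resP _ xy1; apply: fxy; rewrite gmulfR.
apply/eqP/commgP; move: xq => [h _ hxq].
have xqy : commute (vertex_hom GG _ (x ^+ q)) (vertex_hom GG _ y).
  rewrite -hxq vertex_hom_edge -(vertex_hom_edge (~~ eps)).
  by apply: gmulf_commute; apply: edge_central; exists h.
have [n n0 fxn] := C_periodic CQ (f (vertex_hom GG _ x)).
have [m fxm] := has_order_ex n0 fxn; have [m0 fxm1 _] := fxm.
have qm : ~~ (q %| m)%N.
  by apply/negP=> q_m; apply: Cq; split=> //; exists Q => //; exists (f (vertex_hom GG _ x)), m.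
have [u [r ur]] : exists u r, (q * u = m * r + 1)%N.
  case: (egcdnP m (prime_gt0 q_pr)) => u r e_ur _; exists u, r.
  by rewrite mulnC e_ur mulnC; congr addn; apply/eqP; rewrite -/(coprime _ _) prime_coprime.
have -> : f (vertex_hom GG _ x) = f (vertex_hom GG _ (x ^+ q)) ^+ u.
  by rewrite homX homX -expgnA ur expgnDr expgnA fxm1 expg1n mul1g expg1.
by apply/commute_sym/commuteX/commute_sym/gmulf_commute.
Qed.
End Necessity.

Theorem theorem3p5 (C : group_class) (C_root : root_class C)
    (C_periodic : forall X : groupType, C X -> periodic X)
    (Gamma : finite_graph) (GG : graph_of_groups Gamma)
    (Gamma_tree : is_tree Gamma)
    (edge_central : forall e eps,
       edge_subgroup GG e eps `<=` center (vgroup GG (ends e eps)))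
    (edge_proper : forall e eps, edge_subgroup GG e eps <> [set: _])
    (vgroup_residually : forall v, residually (BN C) (vgroup GG v))
    (vgroup_hom : forall v,
       exists2 Q : groupType, BN C Q &
         exists f : hom (vgroup GG v) Q,
           range f = [set: Q] /\
           forall e eps (ev : ends e eps = v),
             set_inj (edge_subgroup_at GG ev) f) :
  residually C (tree_product GG) <->
  forall e eps, isolated (primes_of' C) (edge_subgroup GG e eps).
Proof.
split; first exact: isolated_of_residually.
exact: residually_of_isolated.
Qed.
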